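(* Let $m\ge 1$ be an integer and let $W=A_{n-1}$ or $W=B_n$, where $n\ge 1$, and let $r$ be the rank of $W$. Then the simplicial complex $\Delta^m_W$ has the homotopy type of a wedge of $N^m_W(r)$ copies of the $(r-1)$-dimensional sphere.
   Context: The rank is $r=n-1$ for $W=A_{n-1}$ and $r=n$ for $W=B_n$. The numbers $N^m_W(i)$, $0\le i\le r$, are the generalized Narayana numbers, given by $$N^m_{A_{n-1}}(i)=\frac{1}{i+1}\binom{n-1}{i}\binom{mn}{i},\qquad N^m_{B_n}(i)=\binom{n}{i}\binom{mn}{i}.$$ In the degenerate case $r=0$ the complex is $\{\emptyset\}$, whose realization is the empty space, regarded as the $(-1)$-sphere. Two diagonals of a convex polygon cross if they meet in their relative interiors. Definition of $\Delta^m_{A_{n-1}}$. Let $P$ be a convex $(mn+2)$-gon. $\Delta^m_{A_{n-1}}$ is the abstract simplicial complex whose vertices are the diagonals of $P$ that dissect $P$ into an $(mj+2)$-gon and an $(m(n-j)+2)$-gon for some $1\le j\le n-1$, and whose faces are the sets of pairwise noncrossing diagonals of this type. Definition of $\Delta^m_{B_n}$. Let $P$ be a centrally symmetric convex polygon with $2mn+2$ vertices labeled in anticlockwise order $1,2,\ldots,mn+1,\overline{1},\overline{2},\ldots,\overline{mn+1}$ (with the convention $\overline{\overline{i}}=i$). A $B$-diagonal of $P$ is either (i) a diameter, i.e. a diagonal joining antipodal points $i$ and $\overline{i}$ for some $1\le i\le mn+1$, or (ii) a pair of noncrossing diagonals $ij,\ \overline{i}\,\overline{j}$ for two distinct $i,j\in\{1,\ldots,mn+1,\overline{1},\ldots,\overline{mn+1}\}$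 that are nonconsecutive around the boundary of $P$. Two $B$-diagonals are noncrossing if no diagonal of one crosses a diagonal of the other. $\Delta^m_{B_n}$ is the abstract simplicial complex whose vertices are the $B$-diagonals that dissect $P$ into a pair of $(mj+2)$-gons and a centrally symmetric $(2m(n-j)+2)$-gon for some $1\le j\le n$ (for $j=n$ the central polygon degenerates to a 2-gon and the $B$-diagonal is a diameter), and whose faces are the sets of pairwise noncrossing $B$-diagonals of this type. *)

(* Defs.v *)
From HB Require Import structures.
From mathcomp Require Import all_boot all_order all_algebra.
From mathcomp Require Import all_classical all_reals all_analysis.
From mathcomp Require Import homotopy.

Set Implicit Arguments.
Unset Strict Implicit.
Unset Printing Implicit Defensive.

Import Order.TTheory GRing.Theory Num.Theory.
Import numFieldNormedType.Exports.

Local Open Scope classical_set_scope.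
Local Open Scope ring_scope.

Section Homotopy.
Context (R : realType).

Definition homotopic (X Y : topologicalType) (f g : X -> Y) : Prop :=
  exists H : X * R -> Y,
    [/\ {within [set: X] `*` `[0, 1], continuous H},
        forall x, H (x, 0) = f x & forall x, H (x, 1) = g x].

Definition homotopy_equivalent (X Y : topologicalType) : Prop :=
  exists (f : X -> Y) (g : Y -> X),
    [/\ continuous f, continuous g,
        homotopic (g \o f) idfun & homotopic (f \o g) idfun].

(* The (d-1)-dimensional sphere, as a subset of R^d; it is empty for d = 0. *)
Definition unit_sphere (d : nat) : set 'rV[R]_d :=
  [set x | \sum_i x ord0 i ^+ 2 = 1].
Arguments unit_sphere d : clear implicits.

Lemma sphere_delta (d : nat) :
  (delta_mx ord0 ord0 : 'rV[R]_d.+1) \in unit_sphere d.+1.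
Proof.
rewrite inE /unit_sphere /= (bigD1 ord0) //= mxE !eqxx expr1n big1 ?addr0 //.
by move=> i /negbTE i0; rewrite mxE i0 andbF expr0n.
Qed.

Definition sphere_base (d : nat) : unit_sphere d.+1 :=
  SigSub (sphere_delta d).

(* X has the homotopy type of a wedge of k copies of the (d-1)-sphere.
   The (-1)-sphere is empty, hence has no basepoint: only the wedge of exactly
   one copy of it makes sense, and it is the (-1)-sphere itself. *)
Definition homotopic_to_wedge_of_spheres (X : topologicalType) (k d : nat) :
    Prop :=
  match d with
  | 0 => k = 1%N /\ homotopy_equivalent X (unit_sphere 0)
  | d'.+1 => homotopy_equivalent X (wedge (fun _ : 'I_k => sphere_base d'))
  end.

End Homotopy.
Arguments unit_sphere R d : clear implicits.

Record simplicial_complex (V : finType) := SimplicialComplex {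
  faces :> set {set V};
  faces0 : faces finset.set0;
  faces_sub : forall F G : {set V}, G \subset F -> faces F -> faces G
}.

Definition realization (R : realType) (V : finType) (K : simplicial_complex V) :
    set {ptws V -> (R : topologicalType)} :=
  [set x : V -> R | [/\ forall v, 0 <= x v, \sum_v x v = 1 &
                        faces K [set v | x v != 0]%SET]].
Arguments realization R {V} K _.

Section PairwiseComplex.
Context (V : finType) (vertex : set V) (cross : V -> V -> Prop).

Definition noncrossing_set (F : {set V}) : Prop :=
  (forall D, D \in F -> vertex D) /\
  (forall D E, D \in F -> E \in F -> D != E -> ~ cross D E).

Lemma noncrossing_set0 : noncrossing_set finset.set0.
Proof. by split=> [D|D E]; rewrite finset.in_set0. Qed.

Lemma noncrossing_set_sub (F G : {set V}) :
  G \subset F -> noncrossing_set F -> noncrossing_set G.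
Proof.
move=> /fintype.subsetP GF [Fv Fc]; split=> [D /GF|D E /GF DF /GF EF].
  exact: Fv.
exact: Fc.
Qed.

Definition noncrossing_complex : simplicial_complex V :=
  SimplicialComplex noncrossing_set0 noncrossing_set_sub.

End PairwiseComplex.

Section Polygon.
Context (R : realType) (N : nat) (P : 'I_N -> 'rV[R]_2).
Implicit Types (a b c : 'I_N) (D E : {set 'I_N}).

Definition orientation (p q s : 'rV[R]_2) : R :=
  (q ord0 ord0 - p ord0 ord0) * (s ord0 ord_max - p ord0 ord_max) -
  (q ord0 ord_max - p ord0 ord_max) * (s ord0 ord0 - p ord0 ord0).

(* P lists, in anticlockwise order, the vertices of a convex N-gon (N >= 3):
   all other vertices lie strictly to the left of each oriented side. *)
Definition convex_polygon : Prop :=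
  forall a c, c != a -> c != ordS a -> 0 < orientation (P a) (P (ordS a)) (P c).

Definition is_diagonal a b : bool := [&& a != b, b != ordS a & a != ordS b].

(* Diagonals are represented by their sets of two endpoints. *)
Definition relative_interior D : set 'rV[R]_2 :=
  [set x | exists a b (t : R), [/\ D = [set a; b]%SET, a != b, 0 < t < 1 &
                                   x = (1 - t) *: P a + t *: P b]].

Definition cross D E : Prop :=
  relative_interior D `&` relative_interior E !=set0.

(* The number of sides of the anticlockwise boundary path from a to b. *)
Definition boundary_dist a b : nat := ((b + N - a) %% N)%N.

(* The vertices a, a+1, ..., b of the anticlockwise boundary path from a to b.
   The diagonal ab dissects the polygon into the polygons with vertex sets
   boundary_arc a b and boundary_arc b a. *)
Definition boundary_arc a b : {set 'I_N} :=
  [set c | (boundary_dist a c <= boundary_dist a b)%N]%SET.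

End Polygon.

Definition narayanaA (m n i : nat) : rat :=
  (i.+1%:R)^-1 * 'C(n.-1, i)%:R * 'C(m * n, i)%:R.

Definition narayanaB (m n i : nat) : rat := 'C(n, i)%:R * 'C(m * n, i)%:R.

Section DeltaA.
Context (R : realType) (m n : nat) (P : 'I_(m * n).+2 -> 'rV[R]_2).

Definition vertexA : set {set 'I_(m * n).+2} :=
  [set D | exists a b (j : nat),
    [/\ D = [set a; b]%SET, is_diagonal a b, (1 <= j <= n.-1)%N,
        #|boundary_arc a b| = (m * j + 2)%N &
        #|boundary_arc b a| = (m * (n - j) + 2)%N]].

Definition DeltaA : simplicial_complex {set 'I_(m * n).+2} :=
  noncrossing_complex vertexA (cross P).

End DeltaA.

Section DeltaB.
Context (R : realType) (m n : nat) (P : 'I_(2 * m * n).+2 -> 'rV[R]_2).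
Local Notation I := 'I_(2 * m * n).+2.
Implicit Types (a b i j : I).

(* With the vertices numbered 0, ..., 2mn+1 anticlockwise, the labels
   1, ..., mn+1 are 0, ..., mn and their barred versions are mn+1, ..., 2mn+1. *)
Definition bar (i : I) : I := iter (m * n).+1 (@ordS _) i.

Definition centrally_symmetric : Prop :=
  exists c : 'rV[R]_2, forall i, P (bar i) = c *+ 2 - P i.

(* A B-diagonal is represented by the set of the one or two diagonals
   that it consists of. *)
Definition Bdiagonal (D : {set {set I}}) : Prop :=
  (exists i, D = [set [set i; bar i]]%SET) \/
  (exists i j, [/\ is_diagonal i j, ~ cross P [set i; j] [set bar i; bar j] &
                   D = [set [set i; j]; [set bar i; bar j]]%SET]).

Definition Bcross (D E : {set {set I}}) : Prop :=
  exists d e, [/\ d \in D, e \in E & cross P d e].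

(* boundary_arc a b and boundary_arc (bar a) (bar b) are the vertex sets of the
   two outer polygons, and the vertices of the central one are those lying on
   both of the complementary paths. For a diameter, bar a = b, the two outer
   polygons are the two halves of P and the central one has vertex set {a, b}. *)
Definition vertexB : set {set {set I}} :=
  [set D | Bdiagonal D /\ exists a b (j : nat),
    [/\ D = [set [set a; b]; [set bar a; bar b]]%SET, (1 <= j <= n)%N,
        #|boundary_arc a b| = (m * j + 2)%N,
        #|boundary_arc (bar a) (bar b)| = (m * j + 2)%N &
        #|boundary_arc b a :&: boundary_arc (bar b) (bar a)| =
          (2 * m * (n - j) + 2)%N]].

Definition DeltaB : simplicial_complex {set {set I}} :=
  noncrossing_complex vertexB Bcross.

End DeltaB.

(* Main.v *)
Require Import Defs.
From mathcomp Require Import all_boot all_order all_algebra.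
From mathcomp Require Import all_classical all_reals all_analysis.
From mathcomp Require Import homotopy.
From mathcomp Require Import zify ring lra.

Set Implicit Arguments.
Unset Strict Implicit.
Unset Printing Implicit Defensive.

Import Order.TTheory GRing.Theory Num.Theory.
Import numFieldNormedType.Exports.

Local Open Scope classical_set_scope.
Local Open Scope ring_scope.

(** The faces of each complex are matched in pairs [s], [v |: s], all but
    [N^m_W(r)] of them, which are facets of dimension [r - 1], in such a way that
    the remaining faces form a subcomplex that collapses to a point, one pair at
    a time. The collapse extends to a homotopy of the whole complex, hence the
    complex is homotopy equivalent to the quotient that pinches the subcomplex
    to a point, and this quotient is a wedge of spheres.

    In type A diagonals are intervals of [0, mn + 1]. The matching looks at the
    cell lying over an interval, and at the end [c] of the first [m] sides of
    that cell: unless [c] is adjacent to the end [b] of the interval, the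
    diagonal [c, b] is added or removed. What is left are the dissections that
    are products of such dissections over [m] smaller intervals, so that the
    critical facets are counted by plane [m]-ary trees with [n] nodes.

    In type B each face is compatible with some diameter. The matching adds or
    removes the last compatible diameter [a], in the labelling of the antipodal
    pairs by [0, ..., mn], unless [a] is the last one only because it belongs to
    the face; the faces of the latter kind are handled as in type A. *)

(** * Continuity *)

(** The choice of [c] makes the matching well defined: adding or removing [[c, b]] alters the cell
    over the interval, but not its first [m] sides. Allowed diagonals and sides of the polygon have
    length 1 modulo [m], so after [m] sides the gap [[c, b]] has again length 1 modulo [m]: it is an
    allowed diagonal or a side, and only a side leaves something unmatched. Below the interval no
    diagonal passes over the end of a side of its cell, whence the products. Acyclicity comes from
    sorting the faces by a statistic monotone under inclusion: the length of the first side, or the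
    last compatible diameter. No face has more than [r] vertices and the critical ones have exactly
    [r], so they are facets and the other faces do form a subcomplex. In the topological part, the
    collapses and the sphere coordinates are single formulas on the whole function space, with
    denominators kept away from zero, so that no gluing along faces is needed. Maps descend to the
    wedge because the pinching map has compact source and Hausdorff target. *)

Section Continuity.
Context (R : realType) (X : topologicalType).
Implicit Types f g : X -> R.

Lemma continuous_add f g :
  continuous f -> continuous g -> continuous (fun x => f x + g x).
Proof. by move=> cf cg x; apply: cvgD; [apply: cf|apply: cg]. Qed.

Lemma continuous_sub f g :
  continuous f -> continuous g -> continuous (fun x => f x - g x).
Proof. by move=> cf cg x; apply: cvgB; [apply: cf|apply: cg]. Qed.

Lemma continuous_mul f g :
  continuous f -> continuous g -> continuous (fun x => f x * g x).
Proof. by move=> cf cg x; apply: cvgM; [apply: cf|apply: cg]. Qed.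

Lemma continuous_div f g : (forall x, g x != 0) ->
  continuous f -> continuous g -> continuous (fun x => f x / g x).
Proof.
move=> g0 cf cg; apply: continuous_mul => // x.
by apply: cvgV; [exact: g0|exact: cg].
Qed.

Lemma continuous_minr f g :
  continuous f -> continuous g -> continuous (fun x => Num.min (f x) (g x)).
Proof. by move=> cf cg x; apply: (@continuous_min R X f g x (cf x) (cg x)). Qed.

Lemma continuous_maxr f g :
  continuous f -> continuous g -> continuous (fun x => Num.max (f x) (g x)).
Proof. by move=> cf cg x; apply: (@continuous_max R X f g x (cf x) (cg x)). Qed.

Lemma continuous_if (b : bool) f g : continuous f -> continuous g ->
  continuous (fun x => if b then f x else g x).
Proof. by case: b. Qed.

Lemma continuous_ptws (V : Type) (f : X -> {ptws V -> (R : topologicalType)}) :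
  (forall v, continuous (fun x => f x v)) -> continuous f.
Proof.
move=> cf x; apply/cvg_sup => v; apply/cvg_image.
  by rewrite eqEsubset; split=> // y _; exists (fun=> y).
move=> U /(cf v x) Uv; exists ((fun h : V -> R => h v) @^-1` U) => //.
by rewrite image_preimage // eqEsubset; split=> // y _; exists (fun=> y).
Qed.

Lemma continuous_coord (V : eqType) (v : V) :
  continuous (fun h : {ptws V -> (R : topologicalType)} => h v : R).
Proof. exact: (@proj_continuous V (fun=> R) v). Qed.

Lemma continuous_row (n : nat) (f : X -> 'rV[R]_n) :
  (forall i, continuous (fun x => f x ord0 i)) -> continuous f.
Proof.
move=> cf x U [P Pn PU]; rewrite /= nbhs_simpl /=.
have : \forall y \near x, forall i, P ord0 i (f y ord0 i).
  by apply: filter_forall => i; apply: (cf i x); exact: Pn.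
by apply: filterS => y Py; apply: PU => i j; rewrite (ord1 i); exact: Py.
Qed.

End Continuity.

Lemma continuous_fun_pair (X Y Z : topologicalType) (f : X -> Y) (g : X -> Z) :
  continuous f -> continuous g -> continuous (fun x => (f x, g x)).
Proof. by move=> cf cg x; apply: cvg_pair; [exact: cf|exact: cg]. Qed.

Lemma continuous_fun_comp (X Y Z : topologicalType) (f : X -> Y) (g : Y -> Z) :
  continuous f -> continuous g -> continuous (fun x => g (f x)).
Proof. by move=> cf cg x; apply: continuous_comp; [exact: cf|exact: cg]. Qed.

Section SetType.
Context (X Y : topologicalType) (A : set Y).

Lemma continuous_set_type (f : X -> A) :
  continuous (fun x => set_val (f x)) -> continuous f.
Proof. exact: continuous_comp_initial. Qed.

Lemma continuous_set_val : continuous (set_val : A -> Y).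
Proof. exact: initial_continuous. Qed.

End SetType.

(* A closed surjection is a quotient map. *)
Lemma continuous_factor (A B C : topologicalType) (p : A -> B) (h : B -> C) :
  compact [set: A] -> hausdorff_space B -> continuous p ->
  (forall b, exists a, p a = b) -> continuous (h \o p) -> continuous h.
Proof.
move=> cA hB cp sp chp; apply/continuous_closedP => D cD.
have -> : h @^-1` D = p @` ((h \o p) @^-1` D).
  rewrite eqEsubset; split=> [b Db|_ [a Da <-]//].
  by have [a pa] := sp b; exists a => //=; rewrite pa.
apply: compact_closed => //; apply: continuous_compact.
  exact: continuous_subspaceT.
apply: (subclosed_compact _ cA) => //.
by move/continuous_closedP : chp; apply.
Qed.

Lemma compact_set_type (X : topologicalType) (A : set X) :
  compact A -> compact [set: A].
Proof.
move=> cA F FF _.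
pose G : set_system X := [set U | F (set_val @^-1` U)].
have FG : ProperFilter G by exact: fmap_proper_filter.
have GA : G A by rewrite /G /=; apply: filterS filterT => x _; exact: set_valP.
have [x [Ax xG]] := cA G FG GA.
exists (SigSub (mem_set Ax)); split=> // U W FU [_ [ [P oP <-] Px PW] ].
have := xG (set_val @` U) P; case.
- rewrite /G /=; apply: filterS FU => u Uu; by exists u.
- exact: open_nbhs_nbhs.
by move=> _ [ [u Uu <-] Pu]; exists u; split=> //; exact: PW.
Qed.

Lemma hausdorff_inj (X Y : topologicalType) (f : X -> Y) :
  hausdorff_space Y -> continuous f -> injective f -> hausdorff_space X.
Proof.
move=> hY cf fI x y xy; apply: fI; apply: hY => U W Uf Wf.
have [z [Uz Wz]] := xy _ _ (cf _ _ Uf) (cf _ _ Wf).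
by exists (f z).
Qed.

(** * Acyclic matchings and collapses *)

(* [S] lists the unmatched sets. Acyclicity is built in: nothing already
   present lies above the sets being added. *)
Inductive matched (V : finType) : set {set V} -> seq {set V} -> Prop :=
| matched0 : matched set0 [::]
| matched_pair Q S (s : {set V}) v :
    matched Q S -> v \notin s -> (forall t, Q t -> ~~ (s \subset t)) ->
    matched (Q `|` [set s; (v |: s)%SET]) S
| matched_crit Q S (s : {set V}) :
    matched Q S -> (forall t, Q t -> ~~ (s \subset t)) ->
    matched (Q `|` [set s]) (s :: S).

Section Realization.
Context (R : realType) (V : finType).
Local Notation T := {ptws V -> (R : topologicalType)}.
Implicit Types (L : set {set V}) (x : T).

Definition support (x : V -> R) : {set V} := [set v | x v != 0]%SET.

Definition points L : set T :=
  [set x : V -> R | [/\ forall v, 0 <= x v, \sum_v x v = 1 & L (support x)]].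

Definition lower L := forall s t : {set V}, L s -> t \subset s -> L t.

Lemma support_neq0 x : \sum_v x v = 1 -> support x != finset.set0.
Proof.
move=> x1; apply/negP => /eqP x0; have := oner_neq0 R.
rewrite -x1 big1 ?eqxx// => v _; apply/eqP; apply: contraT => xv.
by have := finset.in_set0 v; rewrite -x0 inE xv.
Qed.

Lemma coord_le1 x v : (forall v, 0 <= x v) -> \sum_v x v = 1 -> x v <= 1.
Proof.
by move=> x0 <-; rewrite (bigD1 v) //= lerDl sumr_ge0 // => i _; exact: x0.
Qed.

(* The collapse of [v |: s] through its free face [s], extended to larger
   complexes: coordinates off [v |: s] are first truncated to [0], and only once
   they all vanish does mass move from [s] to [v], so that supports remain
   faces. *)
Section Push.
Context (s : {set V}) (v : V).
Hypothesis vs : v \notin s.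

Definition push_min x := \big[Num.min/1]_(w in s) x w.
(** Lowering every coordinate by at most this amount costs at most half of the total mass [1]. *)
Definition push_thr : R := (2 * #|V|%:R)^-1.
Definition push_out x := \sum_(u | u \notin v |: s) x u.
(** Positive only if [push_out x] is below [t * push_thr]; each coordinate off [v |: s] is then
    below that threshold and has been truncated to [0]. *)
Definition push_rate x t := Num.max 0 (t - push_out x / push_thr).
Definition push_num x t w :=
  if w \in s then x w - push_min x * push_rate x t
  else if w == v then x w + #|s|%:R * (push_min x * push_rate x t)
  else Num.max 0 (x w - t * push_thr).
(** On the simplex, at times in [[0, 1]], this is the plain sum; the maximum with [2^-1] makes the
    quotient continuous everywhere. *)
Definition push_tot x t := Num.max 2^-1 (\sum_w push_num x t w).
Definition push (xt : T * R) : T := fun w => push_num xt.1 xt.2 w / push_tot xt.1 xt.2.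

Lemma push_thr_gt0 : 0 < push_thr.
Proof.
by rewrite invr_gt0 mulr_gt0 ?ltr0n // (cardD1 v).
Qed.

Lemma continuous_push : continuous push.
Proof.
have cx w : continuous (fun xt : T * R => xt.1 w).
  move=> xt; apply: (@continuous_comp _ _ _ fst (fun h : T => h w)).
    exact: cvg_fst.
  exact: continuous_coord.
have ct : continuous (fun xt : T * R => xt.2) by move=> xt; exact: cvg_snd.
have cc c : continuous (fun xt : T * R => c : R) by exact: cst_continuous.
have cmin : continuous (fun xt : T * R => push_min xt.1).
  apply: continuous_big => //; apply: continuous_minr => x; [exact: cvg_fst|exact: cvg_snd].
have cout : continuous (fun xt : T * R => push_out xt.1).
  apply: continuous_big => //; exact: add_continuous.
have crate : continuous (fun xt : T * R => push_rate xt.1 xt.2).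
  apply: continuous_maxr => //; apply: continuous_sub => //.
  exact: continuous_mul.
have cnum w : continuous (fun xt : T * R => push_num xt.1 xt.2 w).
  apply: continuous_if; first by apply: continuous_sub => //; exact: continuous_mul.
  apply: continuous_if.
    by apply: continuous_add => //; apply: continuous_mul => //; exact: continuous_mul.
  by apply: continuous_maxr => //; apply: continuous_sub => //; exact: continuous_mul.
apply: continuous_ptws => w; apply: continuous_div => //.
  by move=> x; rewrite gt_eqF // lt_max invr_gt0 ltr0n.
apply: continuous_maxr => //.
apply: continuous_big => //; exact: add_continuous.
Qed.

Section Point.
Context (x : T) (x_ge0 : forall w, 0 <= x w) (x_sum : \sum_w x w = 1).

Lemma push_out_ge0 : 0 <= push_out x.
Proof. by apply: sumr_ge0 => w _; exact: x_ge0. Qed.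

Lemma push_min_ge0 : 0 <= push_min x.
Proof. by apply: le_bigmin => // w _; exact: x_ge0. Qed.

Lemma push0 : push (x, 0) = x.
Proof.
have r0 : push_rate x 0 = 0.
  apply/max_idPl; rewrite sub0r oppr_le0 divr_ge0 ?push_out_ge0 //.
  exact/ltW/push_thr_gt0.
have n0 : push_num x 0 = x.
  apply/funext => w; rewrite /push_num r0 !mulr0 mul0r subr0 addr0.
  by do 2 case: ifP => // _; apply/max_idPr; exact: x_ge0.
apply/funext => w; rewrite /push /push_tot /= n0 x_sum.
by rewrite (max_idPr _) ?divr1 // invf_le1 ?ler1n ?ltr0n.
Qed.

Context (t : R) (t01 : 0 <= t <= 1).

Lemma push_rate_ge0 : 0 <= push_rate x t.
Proof. by rewrite le_max lexx. Qed.

Lemma push_rate_le1 : push_rate x t <= 1.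
Proof.
rewrite ge_max ler01 /=; have /andP[_ t1] := t01.
apply: le_trans t1; rewrite gerBl divr_ge0 ?push_out_ge0 //.
exact/ltW/push_thr_gt0.
Qed.

Lemma push_num_ge0 w : 0 <= push_num x t w.
Proof.
rewrite /push_num; case: ifP => [ws|_].
  rewrite subr_ge0; apply: (@le_trans _ _ (push_min x)).
    by rewrite ler_piMr ?push_min_ge0 ?push_rate_le1.
  exact: (@bigmin_le_cond _ _ _ _ w).
case: ifP => _; last by rewrite le_max lexx.
by rewrite addr_ge0 // mulr_ge0 // mulr_ge0 ?push_min_ge0 ?push_rate_ge0.
Qed.

Lemma push_sum_ge : 2^-1 <= \sum_w push_num x t w.
Proof.
have -> : 2^-1 = \sum_w x w - \sum_(w : V) push_thr.
  have V0 : #|V|%:R != 0 :> R by rewrite pnatr_eq0 -lt0n (cardD1 v).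
  by rewrite x_sum sumr_const /push_thr -[X in _ - X]mulr_natr; field.
have e : \sum_w push_num x t w =
    \sum_(w in v |: s) x w + \sum_(w | w \notin v |: s) Num.max 0 (x w - t * push_thr).
  rewrite (bigID (fun w => w \in v |: s)) /=; congr (_ + _).
    rewrite !big_setU1 //= {1}/push_num (negbTE vs) eqxx.
    rewrite (eq_bigr (fun w => x w - push_min x * push_rate x t)); last first.
      by move=> w ws; rewrite /push_num ws.
    rewrite sumrB sumr_const -[X in _ + (_ - X)]mulr_natl; ring.
  apply: eq_bigr => w; rewrite !inE negb_or /push_num => /andP[/negbTE -> /negbTE ->].
  by [].
rewrite e -sumrB (bigID (fun w => w \in v |: s)) /=; apply: lerD.
  by apply: ler_sum => w _; rewrite gerBl ltW ?push_thr_gt0.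
apply: ler_sum => w _; rewrite le_max lerD2l lerN2 orbC.
by have /andP[_ t1] := t01; rewrite ler_piMl // ltW // push_thr_gt0.
Qed.

Lemma push_totE : push_tot x t = \sum_w push_num x t w.
Proof. by apply/max_idPr; exact: push_sum_ge. Qed.

Lemma push_tot_gt0 : 0 < push_tot x t.
Proof. by rewrite lt_max invr_gt0 ltr0n. Qed.

Lemma push_ge0 w : 0 <= push (x, t) w.
Proof. by rewrite divr_ge0 ?push_num_ge0 // ltW // push_tot_gt0. Qed.

Lemma push_sum : \sum_w push (x, t) w = 1.
Proof.
by rewrite -mulr_suml -push_totE divff // gt_eqF // push_tot_gt0.
Qed.

Lemma in_support_push w : (w \in support (push (x, t))) = (push_num x t w != 0).
Proof.
by rewrite inE /push /= mulf_eq0 invr_eq0 (gt_eqF push_tot_gt0) orbF.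
Qed.

(** If no mass moves, no coordinate becomes nonzero. If mass moves, the minimum over [s] and the
    rate are both nonzero: the former puts [s] inside the support, the latter makes the coordinates
    off [v |: s] vanish. *)
Lemma support_push : support (push (x, t)) \subset support x \/
  (s \subset support x /\ support (push (x, t)) \subset v |: s).
Proof.
have /andP[t0 t1] := t01.
have [p0|pN0] := eqVneq (push_min x * push_rate x t) 0.
  left; apply/fintype.subsetP => w; rewrite in_support_push inE /push_num p0.
  rewrite mulr0 subr0 addr0; do 2 case: ifP => // _.
  apply: contraNneq => ->; rewrite (max_idPl _) //.
  by rewrite sub0r oppr_le0 mulr_ge0 // ltW // push_thr_gt0.
right; have [mN0 rN0] : push_min x != 0 /\ push_rate x t != 0.
  by apply/andP; rewrite -negb_or -mulf_eq0.
split.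
  apply/fintype.subsetP => w ws; rewrite inE; apply: contra_neq mN0 => xw0.
  apply/eqP; rewrite eq_le push_min_ge0 andbT -xw0.
  exact: (@bigmin_le_cond _ _ _ _ w).
apply/fintype.subsetP => w; rewrite in_support_push; apply: contraNT => wN.
rewrite /push_num; move: (wN); rewrite !inE negb_or => /andP[/negbTE -> /negbTE ->].
rewrite (max_idPl _) // subr_le0 -ler_pdivrMr ?push_thr_gt0 //.
have : push_rate x t > 0 by rewrite lt_def rN0 push_rate_ge0.
rewrite /push_rate lt_max ltxx /= subr_gt0 => /ltW; apply: le_trans.
rewrite ler_pM2r; last by rewrite invr_gt0 push_thr_gt0.
rewrite /push_out (bigD1 w) //= lerDl.
by apply: sumr_ge0 => u _; exact: x_ge0.
Qed.

End Point.

(** With no mass off [v |: s] the rate at time [1] is [1], so a coordinate of [s] attaining the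
    minimum drops to [0]. *)
Lemma push1 x : (forall w, 0 <= x w) -> \sum_w x w = 1 -> s != finset.set0 ->
  support x \subset v |: s -> exists2 w, w \in s & w \notin support (push (x, 1)).
Proof.
move=> x0 x1 /set0Pn[w0 w0s] sx.
have [w ws mw] : {w | w \in s & push_min x = x w}.
  by apply: (eq_bigmin w0) => // w _; exact: coord_le1.
exists w => //; rewrite in_support_push // negbK /push_num ws mw.
rewrite /push_rate /push_out big1 ?mul0r ?subr0 ?(max_idPr _) ?mulr1 ?subrr //.
move=> u /negP us; apply/eqP; apply: contraPT us => xu; apply.
by apply: (fintype.subsetP sx); rewrite inE.
Qed.

End Push.

Lemma points_vertex x v : (forall w, 0 <= x w) -> \sum_w x w = 1 ->
  support x = [set v]%SET -> x = (fun w => (w == v)%:R).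
Proof.
move=> x0 x1 sx; apply/funext => w.
have xw u : u != v -> x u = 0.
  by move=> uv; apply/eqP; apply: contraNT uv => xu; rewrite -finset.in_set1 -sx inE.
have [->|/xw//] := eqVneq w v.
by rewrite -x1 (bigD1 v) //= big1 ?addr0.
Qed.

(** The pair added last is collapsed first: no set of [Q] contains [s], so [s] is a free face of
    [v |: s] in [L]. The first half of the time is spent on [push], the second on the deformation
    for [Q]. Only [L] contracts to a point, but all of [points K] is carried along inside itself. *)
Lemma deformation K L S : matched L S -> S = [::] -> L finset.set0 ->
  lower L -> lower K -> L `<=` K ->
  exists F : T * R -> T, [/\ continuous F,
    forall x, points K x -> F (x, 0) = x,
    forall x (t : R), 0 <= t <= 1 -> points K x -> points K (F (x, t)),
    forall x (t : R), 0 <= t <= 1 -> points L x -> points L (F (x, t)) &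
    exists p, forall x, points L x -> F (x, 1) = p].
Proof.
move=> mL S0; elim: mL S0 => {L S} [//|Q S s v mQ IH vs Qs S0 L0 lL lK LK|//].
have subL : forall r, (Q `|` [set s; (v |: s)%SET]) r -> s \subset r \/ Q r.
  move=> r [|[->|->]]; first by right.
    by left.
  by left; exact: finset.subsetU1.
(* Every set contains the empty one, so a pair with [s] empty is the first to be added: [Q] is
   empty, [L] is a single vertex, and nothing has to move. *)
have [s0|sN0] := eqVneq s finset.set0.
  have Q0 : Q = set0.
    by rewrite -subset0 => r /Qs; rewrite s0 finset.sub0set.
  exists fst; split=> //; first by move=> xt; exact: cvg_fst.
  exists (fun w => (w == v)%:R) => x [x0 x1 Lx]; apply: points_vertex => //.
  have := support_neq0 x1; move: Lx; rewrite Q0 set0U s0 finset.setU0.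
  by case=> -> //; rewrite eqxx.
have lQ : lower Q.
  move=> r r' Qr r'r; case: (subL r'); last by [].
    by apply: lL r'r; left.
  by move=> sr'; have := Qs _ Qr; rewrite (fintype.subset_trans sr' r'r).
have Q0 : Q finset.set0.
  by case: L0 => // -[] /esym e; [rewrite e eqxx in sN0|
    have := finset.setU11 v s; rewrite e inE].
have [F [cF F0 FK FQ [p Fp]]] := IH S0 Q0 lQ lK (fun r Qr => LK r (or_introl Qr)).
have pushL L' (L'sub : Q `|` [set s; (v |: s)%SET] `<=` L') (lL' : lower L') x (t : R) :
    0 <= t <= 1 -> points L' x -> points L' (push s v (x, t)).
  move=> t01 [x0 x1 Lx]; split; [exact: push_ge0|exact: push_sum|].
  have [|[_]] := support_push s v x0 t01; first exact: lL'.
  by apply: lL'; apply: L'sub; right; right.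
(* A support containing [s] is [s] or [v |: s], and [push1] applies; any other support cannot be
   enlarged by the push. *)
have pushQ x : points (Q `|` [set s; (v |: s)%SET]) x -> points Q (push s v (x, 1)).
  move=> px; have t01 : 0 <= (1 : R) <= 1 by rewrite ler01 lexx.
  have [x0 x1 Lx] := px; have [y0 y1 Ly] := pushL _ (@subset_refl _ _) lL _ _ t01 px.
  split=> //; have [sx|sNx] := boolP (s \subset support x).
    have xs : support x \subset v |: s.
      by case: Lx => [/Qs|[->|->]]; rewrite ?sx ?finset.subsetU1.
    have [w ws wN] := @push1 s v x x0 x1 sN0 xs.
    by have [/fintype.subsetP/(_ w ws)|//] := subL _ Ly; rewrite (negbTE wN).
  have [yx|[sx]] := support_push s v x0 t01; last by rewrite sx in sNx.
  by apply: lQ yx; have [sx|//] := subL _ Lx; rewrite sx in sNx.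
have tmin (t : R) : 0 <= t <= 1 -> 0 <= Num.min 1 (2 * t) <= 1.
  by move=> /andP[t0 t1]; rewrite ge_min lexx le_min ler01 mulr_ge0.
have tmax (t : R) : 0 <= t <= 1 -> 0 <= Num.max 0 (2 * t - 1) <= 1.
  by move=> /andP[t0 t1]; rewrite le_max lexx ge_max ler01 /=; lra.
exists (fun xt => F (push s v (xt.1, Num.min 1 (2 * xt.2)), Num.max 0 (2 * xt.2 - 1))).
have ct : continuous (fun xt : T * R => 2 * xt.2).
  by apply: continuous_mul => [|x]; [exact: cst_continuous|exact: cvg_snd].
split.
- apply: (continuous_fun_comp _ cF); apply: continuous_fun_pair.
    apply: (continuous_fun_comp _ (@continuous_push s v)).
    apply: continuous_fun_pair => [x|]; first exact: cvg_fst.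
    by apply: continuous_minr => //; exact: cst_continuous.
  apply: continuous_maxr; first exact: cst_continuous.
  by apply: continuous_sub => //; exact: cst_continuous.
- move=> x Kx /=; have [x0 x1 _] := Kx.
  have -> : Num.min 1 (2 * 0) = 0 :> R by rewrite mulr0; apply/min_idPr; exact: ler01.
  have -> : Num.max 0 (2 * 0 - 1) = 0 :> R by apply/max_idPl; lra.
  by rewrite push0 // F0.
- move=> x t t01 Kx /=; apply: FK; first exact: tmax.
  by apply: pushL => //; exact: tmin.
- move=> x t /[dup] t01 /andP[t0 t1] Lx /=.
  have [t12|t12] := leP (2 * t) 1.
    rewrite (max_idPl _) ?subr_le0 // F0.
      by apply: pushL => //; rewrite mulr_ge0.
    have [y0 y1 Ly] : points (Q `|` [set s; (v |: s)%SET]) (push s v (x, 2 * t)).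
      by apply: pushL => //; rewrite mulr_ge0.
    by split=> //; exact: LK.
  have [y0 y1 Qy] := FQ (push s v (x, 1)) _ (tmax t t01) (pushQ x Lx).
  by split=> //; left.
exists p => x Lx /=.
have -> : Num.min 1 (2 * 1) = 1 :> R by apply/min_idPl; lra.
have -> : Num.max 0 (2 * 1 - 1) = 1 :> R.
  by rewrite (_ : 2 * 1 - 1 = 1); [apply/max_idPr; exact: ler01|ring].
by apply: Fp; exact: pushQ.
Qed.

End Realization.

(** * A simplex modulo its boundary *)

Section Cell.
Context (R : realType) (V : finType) (d : nat) (e : 'I_d.+1 -> V).
Local Notation T := {ptws V -> (R : topologicalType)}.
Implicit Types (x y : T) (j : 'I_d.+1).

(** Vanishes at [ord0], which leaves that coordinate of [cell] free for the axis through the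
    pole. *)
Definition cell_dir x j := x (e j) - x (e ord0).
Definition cell_min x := \big[Num.min/1]_j x (e j).
Definition cell_rest x := 1 - \sum_j x (e j).
Definition cell_norm x := \sum_j cell_dir x j ^+ 2 + cell_rest x ^+ 2.

(* On the simplex spanned by [e] this is inverse stereographic projection of
   [cell_dir x / cell_min x], so that the boundary goes to the pole. The term
   [cell_rest] keeps the denominator from vanishing off that simplex. *)
Definition cell x : 'rV[R]_d.+1 := \row_j
  ((if j == ord0 then cell_norm x - cell_min x ^+ 2
    else 2 * cell_min x * cell_dir x j) / (cell_norm x + cell_min x ^+ 2)).

Lemma cell_norm_ge0 x : 0 <= cell_norm x.
Proof. by rewrite addr_ge0 ?sqr_ge0 // sumr_ge0 // => j _; exact: sqr_ge0. Qed.

(** If both terms vanished, the coordinates along [e] would be all equal with sum [1], and yet have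
    minimum [0]. *)
Lemma cell_denom_gt0 x : 0 < cell_norm x + cell_min x ^+ 2.
Proof.
rewrite lt_def addr_ge0 ?cell_norm_ge0 ?sqr_ge0 // andbT.
apply/negP; rewrite paddr_eq0 ?cell_norm_ge0 ?sqr_ge0 // => /andP[].
rewrite paddr_eq0 ?sqr_ge0 ?sumr_ge0 // => [|j _]; last exact: sqr_ge0.
rewrite !sqrf_eq0 psumr_eq0 => [|j _]; last exact: sqr_ge0.
move=> /andP[/allP d0 /eqP r0] /eqP m0.
have xe j : x (e j) = x (e ord0).
  have := d0 j; rewrite mem_index_enum => /(_ isT).
  by rewrite sqrf_eq0 subr_eq0 => /eqP.
have m1 : x (e ord0) = 0 \/ (1 : R) = 0.
  have [->|] := eqVneq (x (e ord0)) 0; first by left.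
  move=> xN0; right; move: m0; rewrite /cell_min.
  under eq_bigr do rewrite xe.
  elim/big_ind: _ => //; last by move=> j _ /eqP; rewrite (negbTE xN0).
  by move=> a b ha hb; rewrite /Order.min; case: ifP.
case: m1 => [x0|/eqP]; last by rewrite oner_eq0.
move: r0; rewrite /cell_rest big1 ?subr0 => [/eqP|j _]; first by rewrite oner_eq0.
by rewrite xe.
Qed.

Lemma continuous_cell : continuous cell.
Proof.
have ce j : continuous (fun x : T => x (e j)) by exact: continuous_coord.
have cc (c : R) : continuous (fun _ : T => c) by exact: cst_continuous.
have cdir j : continuous (cell_dir ^~ j) by exact: continuous_sub.
have cmin : continuous cell_min.
  by apply: continuous_big => //; apply: continuous_minr => z;
    [exact: cvg_fst|exact: cvg_snd].
have cadd : continuous (fun z : R * R => z.1 + z.2) by exact: add_continuous.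
have crest : continuous cell_rest.
  by apply: continuous_sub => //; exact: continuous_big.
have csqr (f : T -> R) : continuous f -> continuous (fun x => f x ^+ 2).
  by move=> cf; exact: continuous_mul.
have cnorm : continuous cell_norm.
  apply: continuous_add; last exact: csqr.
  by apply: continuous_big => // j _; exact: csqr.
apply: continuous_row => j.
have -> : (fun x : T => cell x ord0 j) = (fun x => ((if j == ord0
    then cell_norm x - cell_min x ^+ 2 else 2 * cell_min x * cell_dir x j) /
    (cell_norm x + cell_min x ^+ 2))) by apply/funext => x; rewrite mxE.
apply: continuous_div => [x||].
- by rewrite gt_eqF // cell_denom_gt0.
- apply: continuous_if; first by apply: continuous_sub => //; exact: csqr.
  by apply: continuous_mul => //; exact: continuous_mul.
by apply: continuous_add => //; exact: csqr.
Qed.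

(** The squared length is [1] up to a multiple of [cell_min x ^+ 2 * cell_rest x ^+ 2], the error
    made by counting [cell_rest] in [cell_norm]. *)
Lemma cell_sphere x : cell_min x * cell_rest x = 0 -> unit_sphere R d.+1 (cell x).
Proof.
move=> mr; rewrite /unit_sphere /= (bigD1 ord0) //= mxE eqxx.
have D0 := lt0r_neq0 (cell_denom_gt0 x).
rewrite (eq_bigr (fun j => (2 * cell_min x) ^+ 2 /
    (cell_norm x + cell_min x ^+ 2) ^+ 2 * cell_dir x j ^+ 2)); last first.
  by move=> j /negbTE j0; rewrite mxE j0; field.
rewrite -mulr_sumr.
have -> : \sum_(j | j != ord0) cell_dir x j ^+ 2 = cell_norm x - cell_rest x ^+ 2.
  rewrite /cell_norm [in RHS](bigD1 ord0) //= {2}/cell_dir subrr expr0n /= add0r.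
  by rewrite addrK.
have mr2 : cell_min x ^+ 2 * cell_rest x ^+ 2 = 0 by rewrite -exprMn mr expr0n.
have -> : (2 * cell_min x) ^+ 2 / (cell_norm x + cell_min x ^+ 2) ^+ 2 *
    (cell_norm x - cell_rest x ^+ 2) =
  4 * (cell_min x ^+ 2 * cell_norm x - cell_min x ^+ 2 * cell_rest x ^+ 2) /
    (cell_norm x + cell_min x ^+ 2) ^+ 2 by field.
by rewrite mr2; field.
Qed.

Lemma cell_base x : cell_min x = 0 -> cell x = delta_mx ord0 ord0.
Proof.
move=> m0; apply/rowP => j; rewrite !mxE m0 expr0n /= subr0 addr0 mulr0 mul0r.
have := cell_denom_gt0 x; rewrite m0 expr0n addr0 => A0.
by case: ifP => _ /=; rewrite ?mul0r ?divff // gt_eqF.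
Qed.

Lemma cell_baseP x : cell x = delta_mx ord0 ord0 -> cell_min x = 0.
Proof.
move=> /rowP/(_ ord0); rewrite !mxE !eqxx /=.
move=> /(congr1 ( *%R^~ (cell_norm x + cell_min x ^+ 2))).
rewrite mulfVK ?mul1r; last by rewrite gt_eqF // cell_denom_gt0.
by move=> e1; apply/eqP; rewrite -sqrf_eq0; apply/eqP; lra.
Qed.

Lemma cell_ratio x j : j != ord0 -> cell_min x != 0 ->
  cell x ord0 j / (1 - cell x ord0 ord0) = cell_dir x j / cell_min x.
Proof.
move=> /negbTE j0 m0; rewrite !mxE eqxx j0.
have D0 := lt0r_neq0 (cell_denom_gt0 x).
field; rewrite m0 D0 /=.
rewrite [X in X != 0](_ : _ = 2 * cell_min x ^+ 2); last by ring.
by rewrite mulf_neq0 ?pnatr_eq0 // sqrf_eq0.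
Qed.

Lemma cell_min_le x j : cell_min x <= x (e j).
Proof. exact: bigmin_le. Qed.

(** The ratios of [cell_dir] to [cell_min] agree, so along [e] the point [y] is a multiple of [x] up
    to a shift. Comparison at a coordinate attaining the minimum, done both ways, excludes the
    shift; the sums being [1], the factor is [1]. The bounds by [1] ensure that the minimum, whose
    initial value is [1], is attained. *)
Lemma cell_inj x y : cell_min x > 0 -> cell_min y > 0 ->
  (forall j, x (e j) <= 1) -> (forall j, y (e j) <= 1) ->
  cell_rest x = 0 -> cell_rest y = 0 -> cell x = cell y ->
  forall j, x (e j) = y (e j).
Proof.
move=> mx my x1 y1 rx ry cxy.
have dir a b : cell_min a > 0 -> cell_min b > 0 -> cell a = cell b -> forall j,
    b (e j) - b (e ord0) = cell_min b / cell_min a * (a (e j) - a (e ord0)).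
  move=> ma mb ab j; have [->|j0] := eqVneq j ord0; first by rewrite !subrr mulr0.
  have a0 := lt0r_neq0 ma; have b0 := lt0r_neq0 mb.
  have := cell_ratio j0 a0; rewrite ab (cell_ratio j0 b0) /cell_dir.
  move=> /(congr1 (fun z => z * cell_min b)).
  by rewrite mulfVK // => ->; field.
have half a b : cell_min a > 0 -> cell_min b > 0 -> (forall j, a (e j) <= 1) ->
    cell a = cell b -> cell_min b / cell_min a * a (e ord0) <= b (e ord0).
  move=> ma mb a1 ab.
  have [j _ mj] : {j : 'I_d.+1 | true & cell_min a = a (e j)}.
    by apply: (eq_bigmin ord0).
  have := dir a b ma mb ab j; have := cell_min_le b j; rewrite -mj mulrBr.
  rewrite mulfVK ?lt0r_neq0 //; lra.
have x0 := lt0r_neq0 mx; have y0 := lt0r_neq0 my.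
pose r := cell_min y / cell_min x.
have r0 : r * x (e ord0) = y (e ord0).
  apply/eqP; rewrite eq_le half //= -ler_pdivrMl ?divr_gt0 // invf_div.
  exact: half.
have rj j : r * x (e j) = y (e j).
  by have := dir x y mx my cxy j; rewrite -/r mulrBr r0; lra.
have r1 : r = 1.
  have sx : \sum_j x (e j) = 1 by move: rx; rewrite /cell_rest; lra.
  have : \sum_j y (e j) = 1 by move: ry; rewrite /cell_rest; lra.
  by under eq_bigr do rewrite -rj; rewrite -mulr_sumr sx mulr1.
by move=> j; rewrite -rj r1 mul1r.
Qed.

Lemma cell_surj (p : 'rV[R]_d.+1) : injective e -> unit_sphere R d.+1 p ->
  p != delta_mx ord0 ord0 -> exists x, [/\ forall v, 0 <= x v, \sum_v x v = 1,
    support x = [set e j | j in 'I_d.+1]%SET & cell x = p].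
Proof.
move=> eI p1 pb; pose q := p ord0 ord0.
have p1' : \sum_(j | j != ord0) p ord0 j ^+ 2 = 1 - q ^+ 2.
  by move: p1; rewrite /unit_sphere /= (bigD1 ord0) //= -/q => e1; lra.
have q1 : q < 1.
  rewrite lt_neqAle; apply/andP; split; last first.
    have : 0 <= 1 - q ^+ 2 by rewrite -p1' sumr_ge0 // => j _; exact: sqr_ge0.
    by rewrite expr2 => ?; nra.
  apply: contra pb => /eqP q1; apply/eqP/rowP => j; rewrite mxE eqxx /=.
  have [->|j0] := eqVneq j ord0; first by rewrite -/q q1.
  move: p1'; rewrite q1 expr1n subrr => /eqP.
  rewrite psumr_eq0 => [/allP/(_ j)|i _]; last exact: sqr_ge0.
  by rewrite mem_index_enum j0 sqrf_eq0 => /(_ isT)/eqP.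
(* Stereographic projection of [p]. Shifting its coordinates to have least value [1] and dividing by
   their sum [D] gives a point with minimum [D^-1] and directions [y j / D]. *)
pose y j := if j == ord0 then 0 else p ord0 j / (1 - q).
have [j1 yj1] : exists j1, forall j, y j1 <= y j.
  by exists [arg min_(j < ord0) y j]%O; case: arg_minP => // i _ yi j; exact: yi.
pose z j := 1 + y j - y j1; pose D := \sum_j z j.
have z1 j : 1 <= z j by have := yj1 j; rewrite /z; lra.
have D1 : 1 <= D.
  rewrite /D (bigD1 ord0) //= -[1]addr0 lerD ?z1 // sumr_ge0 // => j _.
  exact: le_trans ler01 (z1 j).
have D0 : D != 0 by rewrite gt_eqF // (lt_le_trans ltr01).
pose v0 := e ord0.
pose x : T := fun v => if [pick j | e j == v] is Some j then z j / D else 0.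
have xe j : x (e j) = z j / D.
  by rewrite /x; case: pickP => [i /eqP/eI -> //|/(_ j)]; rewrite eqxx.
have xN v : v \notin [set e j | j in 'I_d.+1]%SET -> x v = 0.
  rewrite /x; case: pickP => // j /eqP <- /negP; case; exact: imset_f.
have sumx (f : V -> R) : (forall v, v \notin [set e j | j in 'I_d.+1]%SET -> f v = 0) ->
    \sum_v f v = \sum_j f (e j).
  move=> fN; rewrite (bigID (mem [set e j | j in 'I_d.+1]%SET)) /= [X in _ + X]big1.
    by rewrite addr0 big_imset //= => i j _ _; exact: eI.
  by move=> v; exact: fN.
have zD j : 0 < z j / D by rewrite divr_gt0 // (lt_le_trans ltr01).
have x1 : \sum_j x (e j) = 1.
  by under eq_bigr do rewrite xe; rewrite -mulr_suml divff.
exists x; split.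
- move=> v; have [/imsetP[j _ ->]|/xN -> //] := boolP (v \in [set e j | j in 'I_d.+1]%SET).
  by rewrite xe ltW.
- by rewrite sumx.
- apply/setP => v; rewrite inE.
  have [/imsetP[j _ ->]|/xN ->] := boolP (v \in _); last by rewrite eqxx.
  by rewrite xe gt_eqF.
have mx : cell_min x = D^-1.
  apply/eqP; rewrite eq_le; apply/andP; split.
    apply: (@bigmin_inf _ _ _ _ j1) => //.
    by rewrite xe /z addrK mul1r.
  apply: le_bigmin => [|j _]; first by rewrite invf_le1 // (lt_le_trans ltr01).
  by rewrite xe ler_peMl // invr_ge0 ltW // (lt_le_trans ltr01).
have dx j : cell_dir x j = y j / D.
  rewrite /cell_dir !xe /z /y eqxx; by field.
have rx : cell_rest x = 0 by rewrite /cell_rest x1 subrr.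
have q10 : 1 - q != 0 by rewrite subr_eq0 gt_eqF.
have yy : \sum_j y j ^+ 2 = (1 + q) / (1 - q).
  rewrite (bigD1 ord0) //= {1}/y eqxx expr0n /= add0r.
  rewrite (eq_bigr (fun j => p ord0 j ^+ 2 / (1 - q) ^+ 2)).
    by rewrite -mulr_suml p1'; field.
  by move=> j /negbTE j0; rewrite /y j0 expr_div_n.
have nx : cell_norm x = (1 + q) / (1 - q) / D ^+ 2.
  rewrite /cell_norm rx expr0n addr0 -yy mulr_suml.
  by apply: eq_bigr => j _; rewrite dx expr_div_n.
have den : cell_norm x + cell_min x ^+ 2 = 2 / (1 - q) / D ^+ 2.
  by rewrite nx mx; field; rewrite D0 q10.
apply/rowP => j; rewrite mxE den nx mx dx /y.
by have [->|j0] := eqVneq j ord0; [rewrite -/q|]; field; rewrite D0 q10.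
Qed.

End Cell.

(** * Wedges of spheres *)

Lemma hausdorff_pair (X Y : topologicalType) :
  hausdorff_space X -> hausdorff_space Y -> hausdorff_space (X * Y)%type.
Proof.
move=> hX hY [x1 y1] [x2 y2] cl; congr (_, _).
  apply: hX => A B Ax Bx.
  have [z [Az Bz]] := cl (fst @^-1` A) (fst @^-1` B) (cvg_fst Ax) (cvg_fst Bx).
  by exists z.1.
apply: hY => A B Ay By.
have [z [Az Bz]] := cl (snd @^-1` A) (snd @^-1` B) (cvg_snd Ay) (cvg_snd By).
by exists z.2.
Qed.

(** The empty set cannot be the larger set of a pair, so its partner is a singleton. The vertex
    obtained will be a preimage of the base point of the wedge. *)
Lemma matched_vertex (V : finType) (Q : set {set V}) S :
  matched Q S -> S = [::] -> Q finset.set0 -> exists v, Q [set v]%SET.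
Proof.
elim=> {Q S} [//|Q S s v mQ IH vs Qs S0|//].
have vN0 : (v |: s)%SET <> finset.set0.
  by move/setP/(_ v); rewrite finset.setU11 finset.in_set0.
case=> [Q0|[s0|/esym/vN0//]]; first by have [w Qw] := IH S0 Q0; exists w; left.
by exists v; right; right; rewrite -s0 finset.setU0.
Qed.

Lemma compact_points (R : realType) (V : finType) (K : set {set V}) :
  lower K -> compact (@points R V K).
Proof.
move=> lK; pose T := {ptws V -> (R : topologicalType)}.
have cube : compact [set x : T | forall v, `[0, 1]%classic (x v)].
  exact: (@tychonoff V (fun=> R) (fun=> `[0, 1]%classic) (fun=> @segment_compact R 0 1)).
apply: (subclosed_compact _ cube); last first.
  move=> x [x0 x1 _] v; rewrite /= in_itv /= x0 /=; exact: coord_le1.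
have -> : @points R V K = \bigcup_(F in [set F | K F])
    [set x : T | (forall v, 0 <= x v) /\ \sum_v x v = 1 /\
                 forall v, v \notin F -> x v = 0].
  rewrite eqEsubset; split=> x.
    move=> [x0 x1 Kx]; exists (support x) => //; split=> //; split=> // v.
    by rewrite inE negbK => /eqP.
  move=> [F KF [x0 [x1 xF]]]; split=> //; apply: lK KF _.
  by apply/fintype.subsetP => v; rewrite inE; apply: contraNT => /xF ->.
apply: closed_bigcup => [|F _]; first exact: finite_finset.
have cv v : continuous (fun x : T => x v : R) by exact: continuous_coord.
have csum : continuous (fun x : T => \sum_v x v : R).
  by apply: continuous_big => //; exact: add_continuous.
have clo (f : T -> R) (D : set R) : closed D -> continuous f -> closed (f @^-1` D).
  by move=> cD cf; apply: preimage_closed => // x _; exact: cf.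
have -> : [set x : T | (forall v, 0 <= x v) /\ \sum_v x v = 1 /\
      forall v, v \notin F -> x v = 0] =
    (\bigcap_v ((fun x : T => x v) @^-1` [set y | 0 <= y])) `&`
    (((fun x : T => \sum_v x v) @^-1` [set y | y = 1]) `&`
    \bigcap_(v in [set v | v \notin F]) ((fun x : T => x v) @^-1` [set y | y = 0])).
  rewrite eqEsubset; split=> x /=.
    by move=> [x0 [x1 xF]]; split; [move=> v _; exact: x0|split].
  by move=> [x0 [x1 xF]]; split; [move=> v; exact: x0|split].
apply: closedI; last apply: closedI.
- by apply: closed_bigI => v _; apply: clo; [exact: closed_ge|exact: cv].
- by apply: clo; [exact: closed_eq|].
by apply: closed_bigI => v _; apply: clo; [exact: closed_eq|exact: cv].
Qed.

Section WedgeOfSpheres.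
Context (R : realType) (V : finType) (K : simplicial_complex V).
Context (S : seq {set V}) (d : nat).
Hypothesis S_uniq : uniq S.
Hypothesis S_gt0 : (0 < size S)%N.
Hypothesis S_face : forall s, s \in S -> faces K s.
Hypothesis S_card : forall s, s \in S -> #|s| = d.+1.
Hypothesis S_max : forall s t, s \in S -> faces K t -> s \subset t -> t = s.
Let L := [set t | faces K t /\ t \notin S].
Hypothesis L_matched : matched L [::].

Local Notation T := {ptws V -> (R : topologicalType)}.
Local Notation X := (realization R K).
Local Notation sphere := (unit_sphere R d.+1).
Local Notation base := (sphere_base R d).
Local Notation I := 'I_(size S).
Local Notation W := (wedge (fun _ : I => base)).
Local Notation point x := (set_val (x : X)).

Let s_ (i : I) := nth finset.set0 S i.

Let s_mem i : s_ i \in S. Proof. exact: mem_nth. Qed.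

Let s_inj : injective s_.
Proof. by move=> i j /eqP; rewrite nth_uniq // => /eqP/val_inj. Qed.

Let enum_ex : {e : I -> 'I_d.+1 -> V & forall i,
  injective (e i) /\ [set e i j | j in 'I_d.+1]%SET = s_ i}.
Proof.
apply: (@choice _ _ (fun i (e : 'I_d.+1 -> V) => injective e /\
  [set e j | j in 'I_d.+1]%SET = s_ i)) => i.
have ci : d.+1 = #|s_ i| by rewrite S_card.
exists (fun j => enum_val (cast_ord ci j)); split.
  by move=> j k /enum_val_inj/cast_ord_inj.
apply/setP => v; apply/imsetP/idP => [[j _ ->]|vi]; first exact: enum_valP.
exists (cast_ord (esym ci) (enum_rank_in vi v)) => //.
by rewrite cast_ordKV enum_rankK_in.
Qed.

Let e := projT1 enum_ex.
Let e_inj i : injective (e i). Proof. by have [] := projT2 enum_ex i. Qed.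
Let e_im i : [set e i j | j in 'I_d.+1]%SET = s_ i.
Proof. by have [] := projT2 enum_ex i. Qed.

Let lowerK : lower (faces K). Proof. by move=> s t Ks ts; apply: faces_sub Ks. Qed.

Let lowerL : lower L.
Proof.
move=> s t [Ks sS] ts; split; first exact: faces_sub Ks.
by apply: contra sS => tS; rewrite (S_max tS Ks ts).
Qed.

Let L0 : L finset.set0.
Proof.
split; first exact: faces0.
by apply/negP => /S_card; rewrite cards0.
Qed.

Let cell_minP i (x : T) : points (faces K) x ->
  (cell_min (e i) x != 0) = (support x == s_ i).
Proof.
move=> [x0 x1 Kx]; apply/idP/eqP => [m0|sx].
  apply: (S_max (s_mem i)) => //; rewrite -e_im.
  apply/fintype.subsetP => _ /imsetP[j _ ->]; rewrite inE.
  apply: contra_neq m0 => xe0; apply/eqP; rewrite eq_le -{1}xe0 cell_min_le.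
  by apply: le_bigmin => // k _; exact: x0.
rewrite gt_eqF //; apply: lt_bigmin => // j _.
rewrite lt_def x0 andbT; have : e i j \in support x by rewrite sx -e_im imset_f.
by rewrite inE.
Qed.

Let cell_min_uniq i j (x : T) : points (faces K) x ->
  cell_min (e i) x != 0 -> cell_min (e j) x != 0 -> i = j.
Proof.
by move=> Kx; rewrite !cell_minP // => /eqP -> /eqP/s_inj.
Qed.

Let cell_restE i (x : T) : points (faces K) x ->
  cell_min (e i) x * cell_rest (e i) x = 0.
Proof.
move=> Kx; have [->|m0] := eqVneq (cell_min (e i) x) 0; first by rewrite mul0r.
have /eqP sx : support x == s_ i by rewrite -cell_minP.
have [x0 x1 _] := Kx.
rewrite /cell_rest -(@big_imset _ _ _ _ _ (e i) 'I_d.+1 x) => [|j k _ _]; last exact: e_inj.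
rewrite e_im /= -sx -x1.
have -> : \sum_v x v = \sum_(v in support x) x v.
  rewrite (bigID (mem (support x))) /= [X in _ + X]big1 ?addr0 //.
  by move=> v; rewrite inE negbK => /eqP.
by rewrite subrr mulr0.
Qed.

Let pointsP (x : X) : points (faces K) (point x). Proof. exact: set_valP. Qed.

Let sph i (x : X) : sphere := SigSub (mem_set (cell_sphere (cell_restE i (pointsP x)))).

Let continuous_sph i : continuous (sph i).
Proof.
apply: continuous_set_type.
exact: (continuous_fun_comp (@continuous_set_val _ X) (@continuous_cell R V d (e i))).
Qed.

Let sph_base i x : (sph i x == base) = (cell_min (e i) (point x) == 0).
Proof.
apply/eqP/eqP => [/(congr1 val)|]; first exact: cell_baseP.
by move=> m0; apply/val_inj; exact: cell_base.
Qed.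

(** * The map pinching the noncritical subcomplex to the base point *)

Let i0 : I := Ordinal S_gt0.

(** The open critical cell that contains [x]. The default [i0] serves the points of the subcomplex,
    where any index yields the base point of the wedge. *)
Let main_cell (x : X) : I :=
  odflt i0 [pick i | cell_min (e i) (point x) != 0].

Let main_cellP x i : i != main_cell x -> sph i x = base.
Proof.
move=> im; apply/eqP; rewrite sph_base; apply: contraNT im => m0.
rewrite /main_cell; case: pickP => [j mj|/(_ i)]; last by rewrite m0.
exact/eqP/(cell_min_uniq (pointsP x)).
Qed.

Let lift i : sphere -> W := @wedge_lift _ _ (fun _ : I => base) i.

Let continuous_lift i : continuous (lift i). Proof. exact: (@wedge_lift_continuous _ _ (fun _ : I => base) i). Qed.

Let lift_base i j : lift i base = lift j base.
Proof. exact: (@wedge_liftE _ _ (fun _ : I => base) j base i base). Qed.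

Let lift_coord i p : wedge_prod (lift i p) = dfwith (fun _ : I => base) i p.
Proof. by rewrite /wedge_prod wedge_lift_funE //; exact: wedge_prod_pointE. Qed.

Let pinch (x : X) : W := lift (main_cell x) (sph (main_cell x) x).

Let pinchE x i : (forall j, j != i -> sph j x = base) -> pinch x = lift i (sph i x).
Proof.
move=> ji; rewrite /pinch; have [-> //|im] := eqVneq (main_cell x) i.
by rewrite ji // main_cellP 1?eq_sym //; exact: lift_base.
Qed.

(** In an open critical cell the index is locally constant. Elsewhere it may jump, but each of the
    finitely many maps [lift i \o sph i] sends the point to the base point, so one neighbourhood
    suits them all. *)
Let continuous_pinch : continuous pinch.
Proof.
move=> x U; have [mx|mx] := eqVneq (cell_min (e (main_cell x)) (point x)) 0.
  have sx i : sph i x = base.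
    have [->|/main_cellP//] := eqVneq i (main_cell x).
    by apply/eqP; rewrite sph_base mx.
  move=> Ux; have Ui : \forall y \near x, forall i : I, U (lift i (sph i y)).
    apply: (@filter_forall X I (fun i y => U (lift i (sph i y))) (nbhs x) (nbhs_filter x)).
    move=> i; have Ui : nbhs (lift i (sph i x)) U.
      rewrite sx; have -> // : lift i base = pinch x.
      by rewrite /pinch sx; exact: lift_base.
    exact: (continuous_fun_comp (@continuous_sph i) (@continuous_lift i)) Ui.
  by apply: filterS Ui => y; apply.
move=> Ux; have cm : continuous (fun y : X => cell_min (e (main_cell x)) (point y)).
  apply: (continuous_fun_comp (@continuous_set_val _ X)).
  by apply: continuous_big => // [|j _]; [apply: continuous_minr => z;
    [exact: cvg_fst|exact: cvg_snd]|exact: continuous_coord].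
have on0 : open [set z : R | z != 0].
  rewrite [X in open X](_ : _ = ~` [set z | z = 0]).
    by apply: closed_openC; exact: closed_eq.
  by rewrite eqEsubset; split=> z /= /eqP.
have near1 : \forall y \near x, cell_min (e (main_cell x)) (point y) != 0.
  by apply: (cm x [set z | z != 0]); apply: open_nbhs_nbhs.
have near2 : \forall y \near x, U (lift (main_cell x) (sph (main_cell x) y)).
  exact: (continuous_fun_comp (@continuous_sph (main_cell x)) (@continuous_lift (main_cell x))) Ux.
apply: filterS2 near1 near2 => y my; rewrite -(@pinchE y (main_cell x)) // => j.
apply: contra_neq_eq; rewrite -[_ != _]/(~~ _) sph_base => mj.
exact: (cell_min_uniq (pointsP y)).
Qed.

Let pinch_sph x y : pinch x = pinch y -> forall i, sph i x = sph i y.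
Proof.
have coordE z i : dfwith (fun _ : I => base) (main_cell z) (sph (main_cell z) z) i = sph i z.
  case: dfwithP => // j; rewrite eq_sym => /main_cellP -> //.
move=> /(congr1 (@wedge_prod _ _ _)) xy i.
by rewrite -(coordE x) -(coordE y); move: xy; rewrite /pinch !lift_coord => ->.
Qed.

Let pinch_inj x y : pinch x = pinch y -> x = y \/ points L (point x) /\ points L (point y).
Proof.
move=> /pinch_sph xy.
have LE z : (forall i, sph i z = base) -> points L (point z).
  have [z0 z1 Kz] := pointsP z; move=> zb; split=> //; split=> //.
  apply/negP => /(nthP finset.set0)[n nS zn].
  have := zb (Ordinal nS); move/eqP; rewrite sph_base.
  by apply/negP; rewrite cell_minP //; rewrite -zn.
have [xb|/existsNP[i xi]] := pselect (forall i, sph i x = base).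
  by right; split; apply: LE => // i; rewrite -xy.
left; have xm : cell_min (e i) (point x) != 0.
  by rewrite -sph_base; exact/eqP.
have ym : cell_min (e i) (point y) != 0 by rewrite -sph_base -xy sph_base.
have pos (z : X) : cell_min (e i) (point z) != 0 -> cell_min (e i) (point z) > 0.
  have [z0 _ _] := pointsP z; move=> zm; rewrite lt_def zm.
  by apply: le_bigmin => // j _; exact: z0.
have le1 (z : X) j : point z (e i j) <= 1.
  by have [z0 z1 _] := pointsP z; exact: coord_le1.
have rest (z : X) : cell_min (e i) (point z) != 0 -> cell_rest (e i) (point z) = 0.
  move=> /negbTE zm; have /eqP := cell_restE i (pointsP z).
  by rewrite mulf_eq0 zm => /eqP.
have xye := cell_inj (pos x xm) (pos y ym) (le1 x) (le1 y) (rest x xm) (rest y ym)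
  (congr1 val (xy i)).
apply/val_inj/funext => v.
have /eqP sx : support (point x) == s_ i by rewrite -cell_minP.
have /eqP sy : support (point y) == s_ i by rewrite -cell_minP.
have [|vN] := boolP (v \in s_ i); first by rewrite -e_im => /imsetP[j _ ->]; exact: xye.
have zv (z : X) : support (point z) = s_ i -> point z v = 0.
  by move=> sz; move: vN; rewrite -sz inE negbK => /eqP.
by rewrite [LHS](zv x sx) [RHS](zv y sy).
Qed.

Let pinch_base x : points L (point x) -> pinch x = lift i0 base.
Proof.
move=> [_ _ [_ zS]]; rewrite /pinch.
have -> : sph (main_cell x) x = base.
  apply/eqP; rewrite sph_base; apply: contraNT zS => m0.
  by move: (m0); rewrite cell_minP // => /eqP ->; exact: s_mem.
exact: lift_base.
Qed.

Let pinch_surj w : exists x, pinch x = w.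
Proof.
have [i [p <-]] : exists i p, lift i p = w.
  by have : [set: W] w by []; rewrite -wedgeTE => -[i _ [p _ <-]]; exists i, p.
have [->|pb] := eqVneq p base.
  have [v Lv] := matched_vertex L_matched erefl L0.
  pose x : T := fun w => (w == v)%:R.
  have sx : support x = [set v]%SET.
    by apply/setP => u; rewrite !inE /x pnatr_eq0 eqb0 negbK.
  have x1 : \sum_u x u = 1.
    by rewrite (bigD1 v) //= /x eqxx big1 ?addr0 // => u /negbTE ->.
  have x0 u : 0 <= x u by rewrite ler0n.
  have Kx : points (faces K) x by split=> //; rewrite sx; case: Lv.
  exists (SigSub (mem_set Kx)); rewrite (lift_base i i0); apply: pinch_base.
  by split=> //=; rewrite sx.
have [x [x0 x1 sx cx]] := cell_surj (@e_inj i) (set_valP p)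
  (contra_neq (fun h => val_inj h) pb).
have Kx : points (faces K) x by split=> //; rewrite sx e_im; exact: S_face.
have xp : sph i (SigSub (mem_set Kx)) = p by apply/val_inj.
exists (SigSub (mem_set Kx)); rewrite -xp; apply: pinchE => j ji.
apply/eqP; rewrite sph_base; apply: contraNT ji => mj; apply/eqP.
apply: (cell_min_uniq Kx mj); rewrite cell_minP //; apply/eqP.
by rewrite sx e_im.
Qed.

(** * Descent of the collapse to the wedge and the homotopy inverse *)

Let unit_itv : set R := `[0, 1]%classic.

Let clamp_proof (t : R) : Num.max 0 (Num.min 1 t) \in unit_itv.
Proof.
by rewrite inE /unit_itv /= in_itv /= le_max lexx ge_max ler01 /= ge_min lexx.
Qed.

(** The descent argument needs a compact interval of times, whereas [homotopic] asks for a map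
    defined at all times in [R]. *)
Let clamp (t : R) : unit_itv := SigSub (clamp_proof t).

Let continuous_clamp : continuous clamp.
Proof.
apply: continuous_set_type; apply: continuous_maxr; first exact: cst_continuous.
by apply: continuous_minr => [|t]; [exact: cst_continuous|exact: cvg_id].
Qed.

Let clampE t : set_val (clamp t) = Num.max 0 (Num.min 1 t). Proof. by []. Qed.

Let clamp0 : set_val (clamp 0) = 0.
Proof. by rewrite clampE (min_idPr _) ?ler01 // (max_idPl _). Qed.

Let clamp1 : set_val (clamp 1) = 1.
Proof. by rewrite clampE (min_idPl _) // (max_idPr _) ?ler01. Qed.

Lemma wedge_of_spheres_aux : homotopy_equivalent R X W.
Proof.
have LK : L `<=` faces K by move=> s [].
have [F [cF F0 FK FL [p Fp]]] := deformation R L_matched erefl L0 lowerL lowerK LK.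
have itvP (t : unit_itv) : 0 <= (set_val t : R) <= 1.
  by have := set_valP t; rewrite /unit_itv /= in_itv.
pose H (xt : X * unit_itv) : X :=
  SigSub (mem_set (FK _ _ (itvP xt.2) (pointsP xt.1))).
have cH : continuous H.
  apply: continuous_set_type.
  apply: (continuous_fun_comp (f := fun xt : X * unit_itv => (set_val xt.1, set_val xt.2)) _ cF).
  apply: continuous_fun_pair.
    by apply: continuous_fun_comp; [move=> x; exact: cvg_fst|exact: continuous_set_val].
  by apply: continuous_fun_comp; [move=> x; exact: cvg_snd|exact: continuous_set_val].
have H0 x : H (x, clamp 0) = x.
  by apply/val_inj; rewrite /H /= clamp0 F0.
have H1 x y : points L (point x) -> points L (point y) -> H (x, clamp 1) = H (y, clamp 1).
  by move=> Lx Ly; apply/val_inj; rewrite /H /= clamp1 !Fp.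
have HL x t : points L (point x) -> points L (point (H (x, t))).
  by move=> Lx; rewrite /H /=; exact: FL.
(* An arbitrary section, continuous or not. The maps built from it do not depend on the choice: it
   is ambiguous only inside [points L], which [H] keeps inside itself and shrinks to a point at time
   [1]. *)
have [j jP] := choice pinch_surj.
have jpinch x : j (pinch x) = x \/ points L (point (j (pinch x))) /\ points L (point x).
  by apply: pinch_inj; rewrite jP.
have cptX : compact [set: X] by apply: compact_set_type; exact: compact_points.
have hausW : hausdorff_space W.
  apply: wedge_hausdorff => _.
  by apply: hausdorff_inj (@continuous_set_val _ sphere) val_inj; exact: norm_hausdorff.
have cI : compact [set: unit_itv] by apply: compact_set_type; exact: segment_compact.
have hI : hausdorff_space unit_itv.
  by apply: hausdorff_inj (@continuous_set_val _ unit_itv) val_inj; exact: norm_hausdorff.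
pose g w := H (j w, clamp 1).
have cg : continuous g.
  apply: (continuous_factor cptX hausW continuous_pinch pinch_surj).
  have -> : g \o pinch = fun x => H (x, clamp 1).
    apply/funext => x /=; rewrite /g; have [|[Lj Lx]] := jpinch x.   by move=> ->.
    exact: H1.
  apply: (continuous_fun_comp _ cH); apply: continuous_fun_pair; last exact: cst_continuous.
  by move=> x; exact: cvg_id.
pose G (wt : W * unit_itv) := pinch (H (j wt.1, wt.2)).
have cG : continuous G.
  (* The product of [pinch] with the identity is again a quotient map, because its source is
     compact. *)
  pose q (xt : X * unit_itv) := (pinch xt.1, xt.2).
  apply: (@continuous_factor _ _ _ q).
  - by rewrite -setXTT; exact: compact_setX.
  - exact: hausdorff_pair.
  - apply: continuous_fun_pair => [|x]; last exact: cvg_snd.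
    by apply: (continuous_fun_comp _ continuous_pinch) => x; exact: cvg_fst.
  - by move=> [w t]; exists (j w, t); rewrite /q /= jP.
  have -> : G \o q = pinch \o H.
    apply/funext => -[x t] /=; rewrite /G /=; have [->//|[Lj Lx]] := jpinch x.
    by rewrite (pinch_base (HL _ t Lj)) (pinch_base (HL _ t Lx)).
  exact: (continuous_fun_comp cH continuous_pinch).
have crev : continuous (fun t : R => clamp (1 - t)).
  apply: (continuous_fun_comp _ continuous_clamp).
  by apply: continuous_sub => [|t]; [exact: cst_continuous|exact: cvg_id].
exists pinch, g; split=> //.
  (* Time is reversed: the collapse starts at the identity, where [homotopic] has to end. *)
  exists (fun xt => H (xt.1, clamp (1 - xt.2))); split.
  - apply: continuous_subspaceT; apply: (continuous_fun_comp _ cH).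
    apply: continuous_fun_pair => [x|]; first exact: cvg_fst.
    by apply: (continuous_fun_comp _ crev) => x; exact: cvg_snd.
  - move=> x /=; rewrite subr0 /g; have [->//|[Lj Lx]] := jpinch x; exact: H1.
  - by move=> x /=; rewrite subrr H0.
exists (fun wt => G (wt.1, clamp (1 - wt.2))); split.
- apply: continuous_subspaceT; apply: (continuous_fun_comp _ cG).
  apply: continuous_fun_pair => [x|]; first exact: cvg_fst.
  by apply: (continuous_fun_comp _ crev) => x; exact: cvg_snd.
- by move=> w; rewrite /G /= subr0.
by move=> w; rewrite /G /= subrr H0 jP.
Qed.

End WedgeOfSpheres.

Theorem wedge_of_spheres (R : realType) (V : finType) (K : simplicial_complex V)
    (S : seq {set V}) (d : nat) :
  uniq S -> (0 < size S)%N -> (forall s, s \in S -> faces K s /\ #|s| = d.+1) ->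
  (forall s t, s \in S -> faces K t -> s \subset t -> t = s) ->
  matched [set t | faces K t /\ t \notin S] [::] ->
  homotopic_to_wedge_of_spheres R (realization R K) (size S) d.+1.
Proof.
move=> Su S0 Sf Smax LS; apply: wedge_of_spheres_aux => // s /Sf[].
  by [].
by [].
Qed.

(** * Operations on matchings *)

Section Matched.
Context (V : finType).
Implicit Types (Q : set {set V}) (S : seq {set V}) (s t : {set V}).

Lemma matched_sub Q S s : matched Q S -> s \in S -> Q s.
Proof.
elim=> {Q S} [//|Q S s' v _ IH _ _ /IH Qs|Q S s' _ IH _]; first by left.
by rewrite inE => /predU1P[->|/IH]; [right|left].
Qed.

Lemma matched_uniq Q S : matched Q S -> uniq S.
Proof.
elim=> {Q S} //= Q S s mQ -> Qs; rewrite andbT.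
by apply/negP => /(matched_sub mQ)/Qs; rewrite fintype.subxx.
Qed.

(** Deleting the critical sets weakens the acyclicity conditions and breaks no pair, since no set
    added earlier lies above the smaller set of a pair. *)
Lemma matched_noncritical Q S :
  matched Q S -> matched [set t | Q t /\ t \notin S] [::].
Proof.
elim=> {Q S} [|Q S s v mQ IH vs Qs|Q S s mQ IH Qs].
- rewrite (_ : [set t | _] = set0); first exact: matched0.
  by rewrite -subset0 => t [].
- rewrite (_ : [set t | _] = [set t | Q t /\ t \notin S] `|` [set s; (v |: s)%SET]).
    by apply: matched_pair => // t [/Qs].
  have sN (r : {set V}) : s \subset r -> r \notin S.
    by move=> sr; apply/negP => /(matched_sub mQ)/Qs; rewrite sr.
  rewrite eqEsubset; split=> t; first by move=> [[Qt|st] tS]; [left|right].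
  move=> [[Qt tS]|st]; first by split=> //; left.
  split; first by right.
  by case: st => ->; apply: sN; rewrite ?fintype.subxx ?finset.subsetU1.
rewrite (_ : [set t | _] = [set t | Q t /\ t \notin S]) //.
rewrite eqEsubset; split=> t.
  move=> [Qst]; rewrite inE negb_or => /andP[ts tS]; split=> //.
  by case: Qst => // /= e; rewrite e eqxx in ts.
move=> [Qt tS]; split; first by left.
rewrite inE negb_or tS andbT; apply/eqP => e.
by have := Qs t Qt; rewrite e fintype.subxx.
Qed.

Lemma matched_union Q1 Q2 S1 S2 : matched Q1 S1 -> matched Q2 S2 ->
  (forall s t, Q2 s -> Q1 t -> ~~ (s \subset t)) -> matched (Q1 `|` Q2) (S2 ++ S1).
Proof.
move=> m1; elim=> {Q2 S2} [_|Q S s v mQ IH vs Qs le12|Q S s mQ IH Qs le12].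
- by rewrite setU0.
- rewrite setUA; apply: matched_pair => // [|t [Qt|/Qs//]].
    by apply: IH => r t Qr; apply: le12; left.
  by apply: le12 => //; right; left.
rewrite setUA; apply: matched_crit => // [|t [Qt|/Qs//]].
  by apply: IH => r t Qr; apply: le12; left.
by apply: le12 => //; right.
Qed.

(** Removing the pair of a largest set [s0] without [v] keeps the family stable under toggling [v].
    A remaining set above [s0] would, deprived of [v], equal [s0] by maximality, and so belong to
    the removed pair. *)
Lemma matched_toggle Q v :
  (forall s, v \notin s -> Q s <-> Q (v |: s)%SET) -> matched Q [::].
Proof.
pose A Q' : {set {set V}} := [set s : {set V} | `[< Q' s >] && (v \notin s)]%SET.
have [n] := ubnP #|A Q|.
elim: n Q => // n IH Q; rewrite ltnS => Qn Qv.
have [A0|[s1 s1A]] := set_0Vmem (A Q).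
  have QN s : v \notin s -> ~ Q s.
    by move=> vs Qs; have := finset.in_set0 s; rewrite -A0 inE vs andbT; move/asboolP.
  rewrite (_ : Q = set0); first exact: matched0.
  rewrite -subset0 => t Qt; have [vt|vt] := boolP (v \in t); last exact: QN Qt.
  have vtv : v \notin t :\ v by rewrite !inE eqxx.
  by apply: (QN _ vtv); apply/(Qv _ vtv); rewrite finset.setD1K.
have [s0 s0A s0max] : {s0 | s0 \in A Q & forall s, s \in A Q -> (#|s| <= #|s0|)%N}.
  exists [arg max_(s > s1 in A Q) #|s|]; by case: arg_maxnP.
move: (s0A); rewrite inE => /andP[/asboolP Qs0 vs0].
have Qvs0 : Q (v |: s0) by apply/(Qv _ vs0).
pose Q' := [set t | [/\ Q t, t <> s0 & t <> (v |: s0)%SET]].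
have QE : Q = Q' `|` [set s0; (v |: s0)%SET].
  rewrite eqEsubset; split=> t.
    move=> Qt; have [ts|ts] := pselect (t = s0); first by right; left.
    have [tv|tv] := pselect (t = (v |: s0)%SET); first by right; right.
    by left.
  by move=> [[]//|[->|->]].
rewrite QE; apply: matched_pair => //.
  apply: IH.
    apply: leq_trans Qn; apply: proper_card; apply/properP; split.
      by apply/fintype.subsetP => t; rewrite !inE => /andP[/asboolP[Qt _ _] ->];
        rewrite andbT; apply/asboolP.
    by exists s0 => //; rewrite inE; apply/negP => /andP[/asboolP[_ /(_ erefl)]].
  move=> s vs; split=> -[Qs ss sv]; split.
  - exact/(Qv _ vs).
  - by move=> e; move: vs0; rewrite -e finset.setU11.
  - move=> e; apply: ss; rewrite -(finset.setU1K vs) e; exact: finset.setU1K.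
  - exact/(Qv _ vs).
  - by move=> e; apply: sv; rewrite e.
  - by move=> e; move: vs; rewrite e finset.setU11.
move=> t [Qt ts0 tv]; apply/negP => s0t.
have tAQ : t :\ v \in A Q.
  rewrite inE; have vtv : v \notin t :\ v by rewrite !inE eqxx.
  rewrite vtv andbT; apply/asboolP; have [vt|vt] := boolP (v \in t).
    by apply/(Qv _ vtv); rewrite finset.setD1K.
  by rewrite (_ : t :\ v = t) //; apply/finset.setDidPl; rewrite disjoint_sym disjoints1.
have s0tv : s0 \subset t :\ v by rewrite finset.subsetD1 s0t vs0.
have e : s0 = t :\ v by apply/eqP; rewrite eqEcard s0tv; exact: s0max.
have [vt|vt] := boolP (v \in t); first by apply: tv; rewrite e finset.setD1K.
apply: ts0; rewrite e; apply/esym/finset.setDidPl.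
by rewrite disjoint_sym disjoints1.
Qed.

End Matched.

Lemma matched_image (V V' : finType) (U : {set V}) (F : {set V} -> {set V'})
    (g : V -> V') (Q : set {set V}) (S : seq {set V}) :
  (forall s t : {set V}, s \subset U -> t \subset U -> F s \subset F t -> s \subset t) ->
  (forall v (s : {set V}), v \in U -> F (v |: s)%SET = (g v |: F s)%SET) ->
  matched Q S -> (forall s : {set V}, Q s -> s \subset U) ->
  matched (F @` Q) (map F S).
Proof.
move=> Fsub Fg; elim=> {Q S} [|Q S s v mQ IH vs Qs|Q S s mQ IH Qs] QU.
- by rewrite image_set0; exact: matched0.
- have vsU : v |: s \subset U by apply: QU; right; right.
  have [vU sU] : v \in U /\ s \subset U.
    by move: vsU; rewrite finset.subUset finset.sub1set => /andP.
  have -> : F @` (Q `|` [set s; (v |: s)%SET]) = F @` Q `|` [set F s; (g v |: F s)%SET].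
    by rewrite image_setU image_setU !image_set1 Fg.
  apply: matched_pair; first by apply: IH => t Qt; apply: QU; left.
    apply/negP => gvs; have : F (v |: s) \subset F s.
      by rewrite Fg // finset.subUset finset.sub1set gvs fintype.subxx.
    by move/(Fsub _ _ vsU sU); rewrite finset.subUset finset.sub1set (negbTE vs).
  move=> _ [t Qt <-]; apply: contra (Qs t Qt); apply: Fsub => //.
  by apply: QU; left.
rewrite image_setU image_set1 /=; apply: matched_crit.
  by apply: IH => t Qt; apply: QU; left.
move=> _ [t Qt <-]; apply: contra (Qs t Qt); apply: Fsub; apply: QU.
  by right.
by left.
Qed.

Definition setprod (V : finType) (Q1 Q2 : set {set V}) : set {set V} :=
  [set s | exists s1 s2, [/\ Q1 s1, Q2 s2 & s = (s1 :|: s2)%SET]].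

(** Built along the first factor: a pair of [Q1] contributes a family stable under toggling [v],
    hence without critical sets, and a critical set of [Q1] contributes a copy of [Q2]. As [U1] and
    [U2] are disjoint, inclusions can be compared factor by factor. *)
Lemma matched_product (V : finType) (U1 U2 : {set V}) (Q1 Q2 : set {set V}) (S1 S2 : seq {set V}) :
  (forall v, v \in U1 -> v \notin U2) ->
  matched Q1 S1 -> (forall s : {set V}, Q1 s -> s \subset U1) ->
  matched Q2 S2 -> (forall s : {set V}, Q2 s -> s \subset U2) ->
  matched (setprod Q1 Q2) [seq (s1 :|: s2)%SET | s1 <- S1, s2 <- S2].
Proof.
move=> U12 m1 QU1 m2 QU2.
have sub12 (s s' t t' : {set V}) : s \subset U1 -> s' \subset U1 -> t \subset U2 -> t' \subset U2 ->
    (s :|: t) \subset (s' :|: t') -> (s \subset s') && (t \subset t').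
  move=> sU s'U tU t'U stst; apply/andP; split; apply/fintype.subsetP => x xs.
    have := fintype.subsetP stst x; rewrite !inE xs => /(_ isT) /orP[//|xt'].
    by have := U12 _ (fintype.subsetP sU _ xs); rewrite (fintype.subsetP t'U).
  have := fintype.subsetP stst x; rewrite !inE xs orbT => /(_ isT) /orP[xs'|//].
  by have := U12 _ (fintype.subsetP s'U _ xs'); rewrite (fintype.subsetP tU).
elim: m1 QU1 => {Q1 S1} [|Q1 S1 s v mQ IH vs Qs|Q1 S1 s mQ IH Qs] QU1.
- rewrite (_ : setprod _ _ = set0); first exact: matched0.
  by rewrite -subset0 => t [s [s']] [].
- have [vU sU] : v \in U1 /\ s \subset U1.
    have := QU1 (v |: s)%SET (or_intror (or_intror erefl)).
    by rewrite finset.subUset finset.sub1set => /andP.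
  have QU1' (t : {set V}) : Q1 t -> t \subset U1 by move=> Qt; apply: QU1; left.
  have -> : setprod (Q1 `|` [set s; (v |: s)%SET]) Q2 =
      setprod Q1 Q2 `|` setprod [set s; (v |: s)%SET] Q2.
    rewrite eqEsubset; split=> t.
      by move=> [a [b [[Qa|sa] Qb ->]]]; [left|right]; exists a, b.
    by move=> [|] [a [b [Qa Qb ->]]]; exists a, b; split=> //; [left|right].
  rewrite -[X in matched _ X]cat0s; apply: matched_union; first exact: IH.
    apply: (@matched_toggle _ _ v) => r vr; split=> -[a [b [[ra|ra] Qb rE]]].
    - exists (v |: s)%SET, b; split=> //; first by right.
      by rewrite rE ra finset.setUA.
    - by move: vr; rewrite rE ra !inE eqxx.
    - have : v \in a :|: b by rewrite -rE finset.setU11.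
      rewrite ra inE (negbTE vs) /= => vb.
      by have := U12 _ vU; rewrite (fintype.subsetP (QU2 _ Qb)).
    exists s, b; split=> //; first by left.
    have vsb : v \notin s :|: b.
      rewrite inE (negbTE vs) /=; apply/negP => vb.
      by have := U12 _ vU; rewrite (fintype.subsetP (QU2 _ Qb)).
    by rewrite -(finset.setU1K vr) rE ra -finset.setUA finset.setU1K.
  move=> _ _ [a [b [sa Qb ->]]] [a' [b' [Qa' Qb' ->]]]; apply/negP => /sub12.
  have aU : a \subset U1 by apply: QU1; right.
  move=> /(_ aU (QU1' _ Qa') (QU2 _ Qb) (QU2 _ Qb')) /andP[aa' _].
  have /negP := Qs _ Qa'; apply; apply: fintype.subset_trans aa'.
  by case: sa => ->; rewrite ?finset.subsetU1.
have sU : s \subset U1 by apply: QU1; right.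
have QU1' (t : {set V}) : Q1 t -> t \subset U1 by move=> Qt; apply: QU1; left.
have -> : setprod (Q1 `|` [set s]) Q2 =
    setprod Q1 Q2 `|` ((fun t => s :|: t)%SET @` Q2).
  rewrite eqEsubset; split=> t.
    by move=> [a [b [[Qa|->] Qb ->]]]; [left; exists a, b|right; exists b].
  move=> [[a [b [Qa Qb ->]]]|[b Qb <-]]; first by exists a, b; split=> //; left.
  by exists s, b; split=> //; right.
apply: matched_union; first exact: IH.
  apply: (@matched_image _ _ U2 _ id) => // [t t' tU t'U|v t vU].
    by move/(sub12 _ _ _ _ sU sU tU t'U) => /andP[].
  by rewrite finset.setUCA.
move=> _ _ [b Qb <-] [a' [b' [Qa' Qb' ->]]]; apply/negP.
move=> /(sub12 _ _ _ _ sU (QU1' _ Qa') (QU2 _ Qb) (QU2 _ Qb')) /andP[sa' _].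
by have := Qs _ Qa'; rewrite sa'.
Qed.

(** The size bound makes the critical sets maximal in [Q], so that they are facets without further
    argument. *)
Definition crit_matched (V : finType) (d : nat) (Q : set {set V}) (k : nat) : Prop :=
  (forall t : {set V}, Q t -> (#|t| <= d)%N) /\
  exists S, [/\ matched Q S, size S = k & forall s : {set V}, s \in S -> #|s| = d].

Section Good.
Context (V : finType).
Implicit Types (Q : set {set V}) (d k : nat).

Lemma crit_matched_set0 d : crit_matched d (@set0 {set V}) 0.
Proof. by split=> //; exists [::]; split=> //; exact: matched0. Qed.

Lemma crit_matched_set1 (s : {set V}) : crit_matched #|s| [set s] 1.
Proof.
split=> [t ->//|]; exists [:: s]; split=> // [|t]; last by rewrite inE => /eqP ->.
by rewrite -[X in matched X]set0U; apply: matched_crit => //; exact: matched0.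
Qed.

Lemma crit_matched_toggle Q d v : (forall t : {set V}, Q t -> (#|t| <= d)%N) ->
  (forall s : {set V}, v \notin s -> Q s <-> Q (v |: s)%SET) -> crit_matched d Q 0.
Proof.
by move=> Qd Qv; split=> //; exists [::]; split=> //; exact: (matched_toggle Qv).
Qed.

Lemma crit_matched_union Q1 Q2 d k1 k2 : crit_matched d Q1 k1 -> crit_matched d Q2 k2 ->
  (forall s t : {set V}, Q2 s -> Q1 t -> ~~ (s \subset t)) ->
  crit_matched d (Q1 `|` Q2) (k1 + k2).
Proof.
move=> [Q1d [S1 [m1 <- S1d]]] [Q2d [S2 [m2 <- S2d]]] le12; split.
  by move=> t [/Q1d|/Q2d].
exists (S2 ++ S1); split; first exact: matched_union.
  by rewrite size_cat addnC.
by move=> s; rewrite mem_cat => /orP[/S2d|/S1d].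
Qed.

Lemma crit_matched_product (U1 U2 : {set V}) Q1 Q2 d1 d2 k1 k2 :
  (forall v, v \in U1 -> v \notin U2) ->
  crit_matched d1 Q1 k1 -> (forall s : {set V}, Q1 s -> s \subset U1) ->
  crit_matched d2 Q2 k2 -> (forall s : {set V}, Q2 s -> s \subset U2) ->
  crit_matched (d1 + d2) (setprod Q1 Q2) (k1 * k2).
Proof.
move=> U12 [Q1d [S1 [m1 <- S1d]]] QU1 [Q2d [S2 [m2 <- S2d]]] QU2; split.
  move=> _ [a [b [Qa Qb ->]]]; apply: leq_trans (finset.leq_card_setU _ _) _.
  by rewrite leq_add ?Q1d ?Q2d.
exists [seq (s1 :|: s2)%SET | s1 <- S1, s2 <- S2]; split.
- exact: (matched_product U12).
- by rewrite size_allpairs.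
move=> s /allpairsP[[a b] /= [aS bS ->]]; rewrite cardsU S1d // S2d //.
rewrite (_ : (a :&: b)%SET = finset.set0) ?finset.cards0 ?subn0 //.
apply/setP => x; rewrite !inE; apply/negP => /andP[xa xb].
have := U12 x; rewrite (fintype.subsetP (QU1 _ (matched_sub m1 aS))) //.
by rewrite (fintype.subsetP (QU2 _ (matched_sub m2 bS))) // => /(_ isT).
Qed.

(** As the index can only increase with the set, adding the layers in increasing order never puts a
    set below an earlier one. *)
Lemma crit_matched_bigcup (Q : nat -> set {set V}) d (k : nat -> nat) n :
  (forall i, (i < n)%N -> crit_matched d (Q i) (k i)) ->
  (forall i j (s t : {set V}), Q i s -> Q j t -> s \subset t -> (i <= j)%N) ->
  crit_matched d [set s | exists2 i, (i < n)%N & Q i s] (\sum_(i < n) k i).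
Proof.
move=> Qi Qij; elim: n Qi => [|n IH] Qi.
  rewrite big_ord0 (_ : [set s | _] = set0); first exact: crit_matched_set0.
  by rewrite -subset0 => s [].
rewrite big_ord_recr /=.
have -> : [set s | exists2 i, (i < n.+1)%N & Q i s] =
    [set s | exists2 i, (i < n)%N & Q i s] `|` Q n.
  rewrite eqEsubset; split=> s.
    move=> [i]; rewrite ltnS leq_eqVlt => /predU1P[->|ltin] Qs; first by right.
    by left; exists i.
  by move=> [[i ltin Qs]|Qs]; [exists i => //; exact: ltnW|exists n].
apply: crit_matched_union; [by apply: IH => i ltin; apply: Qi; exact: ltnW|exact: Qi|].
move=> s t Qs [i ltin Qt]; apply/negP => /(Qij _ _ _ _ Qs Qt).
by rewrite leqNgt ltin.
Qed.

End Good.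

Lemma crit_matched_image (V V' : finType) (U : {set V}) (e : V -> V') (Q : set {set V}) d k :
  {in U &, injective e} -> (forall s : {set V}, Q s -> s \subset U) -> crit_matched d Q k ->
  crit_matched d ((fun s : {set V} => (e @: s)%SET) @` Q) k.
Proof.
move=> eI QU [Qd [S [mS <- Sd]]]; split.
  by move=> _ [t Qt <-]; apply: leq_trans (leq_imset_card _ _) _; exact: Qd.
exists (map (fun s : {set V} => (e @: s)%SET) S); split.
- apply: (@matched_image _ _ U _ e) => // [s t sU tU st|v s vU].
    apply/fintype.subsetP => x xs.
    have /imsetP[y yt exy] : e x \in e @: t.
      by apply: (fintype.subsetP st); exact: imset_f.
    have -> // : x = y.
    by apply: eI => //; [exact: (fintype.subsetP sU)|exact: (fintype.subsetP tU)].
  by rewrite finset.imsetU1.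
- by rewrite size_map.
move=> _ /mapP[s sS ->]; rewrite card_in_imset ?Sd // => x y xs ys.
by apply: eI; apply: (fintype.subsetP (QU _ (matched_sub mS sS))).
Qed.

(** * Raney numbers *)

Section Raney.
Local Open Scope nat_scope.

(* The number of forests of [y] plane [m]-ary trees with [n] internal nodes. *)
Fixpoint raney (m n y : nat) : nat :=
  if n is n'.+1 then \sum_(z < y) raney m n' (z + m) else 1.

(** The first tree is a leaf, or its root is replaced by the [m] subtrees below it. *)
Lemma raneyS m n y : raney m n.+1 y.+1 = raney m n.+1 y + raney m n (y + m).
Proof. by rewrite /= big_ord_recr. Qed.

Lemma raney0 m n : raney m n 0 = (n == 0).
Proof. by case: n => //= n; rewrite big_ord0. Qed.

Lemma raney1 m n : raney m n.+1 1 = raney m n m.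
Proof. by rewrite raneyS raney0. Qed.

(** Both sides obey the same recurrence in [x]. With [H] equal to [raney] this juxtaposes two
    forests; [raney_cyclic] uses it with a binomial coefficient for [H]. *)
Lemma raney_convolution (m : nat) (H : nat -> nat -> nat) :
  (forall y, H 0 y = 1) -> (forall n y, H n.+1 y.+1 = H n.+1 y + H n (y + m)) ->
  forall n x y, \sum_(i < n.+1) raney m i x * H (n - i) y = H n (x + y).
Proof.
move=> H0 HS; elim=> [|n IHn] x y.
  by rewrite big_ord_recr big_ord0 /= !H0.
elim: x => [|x IHx].
  rewrite big_ord_recl /= subn0 mul1n big1 => [|i _]; first by rewrite addn0.
  by rewrite /bump /= big_ord0.
rewrite big_ord_recl /= mul1n subn0.
under eq_bigr => i _ do rewrite /bump /= add1n -/(raney m i.+1 x.+1) raneyS mulnDl subSS.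
rewrite big_split /= addSn HS -IHx addnAC -IHn addnA.
by rewrite [in RHS]big_ord_recl /= mul1n subn0.
Qed.

(** The formula of [raney_closed] with its denominator absorbed by the binomial coefficient. Through
    [raneyS] it follows from [raney_closed] at [n], which is why that is a hypothesis: the two
    alternate in one induction. *)
Lemma raney_succ_closed m n y : 0 < m ->
  (forall z, raney m n z * (m * n + z) = z * 'C(m * n + z, n)) ->
  raney m n.+1 y.+1 * n.+1 = y.+1 * 'C(m * n.+1 + y, n).
Proof.
move=> m0 IHn; elim: y => [|y IHy].
  rewrite raney1 addn0 mul1n.
  have N0 : 0 < m * n + m by rewrite addn_gt0 m0 orbT.
  apply/eqP; rewrite -(eqn_pmul2r N0) mulnAC IHn (mulnS m n) (addnC m).
  by apply/eqP; lia.
pose N := m * n.+1 + y.+1.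
have N0 : 0 < N by rewrite /N addnS.
have nN : n <= N by rewrite /N; nia.
apply/eqP; rewrite -(eqn_pmul2r N0); apply/eqP.
rewrite raneyS mulnDl mulnDl IHy -/N.
have e1 : raney m n (y.+1 + m) * N = (y.+1 + m) * 'C(N, n).
  have -> : N = m * n + (y.+1 + m) by rewrite /N; lia.
  exact: IHn.
have e2 : 'C(m * n.+1 + y, n) * N = (N - n) * 'C(N, n).
  by rewrite -mul_bin_down mulnC /N addnS.
have e3 : raney m n (y.+1 + m) * n.+1 * N = (y.+1 + m) * n.+1 * 'C(N, n).
  by rewrite mulnAC e1 mulnAC.
rewrite -mulnA e2 e3 mulnA -mulnDl [RHS]mulnAC; congr (_ * _).
have q : m * n.+1 + y.+1 = n + (N - n) by rewrite subnKC.
rewrite -[in RHS](subnKC nN); move: (N - n) q => p q; nia.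
Qed.

Lemma raney_closed m n y : 0 < m ->
  raney m n y * (m * n + y) = y * 'C(m * n + y, n).
Proof.
move=> m0; elim: n y => [|n IHn] y; first by rewrite muln0 add0n bin0 mul1n muln1.
case: y => [|y]; first by rewrite raney0 mul0n.
apply/eqP; rewrite -(eqn_pmul2r (ltn0Sn n)) mulnAC raney_succ_closed //.
rewrite -!mulnA; apply/eqP; congr (_ * _); rewrite addnS [RHS]mulnC.
by rewrite -(mul_bin_diag (m * n.+1 + y).+1 n) [LHS]mulnC.
Qed.

(** The Fuss-Catalan numbers, which are the type A Narayana numbers of top index. *)
Lemma raney_tree m n : 0 < m -> raney m n.+1 1 * n.+1 = 'C(m * n.+1, n).
Proof.
move=> m0.
by have := raney_succ_closed 0 m0 (fun z => raney_closed n z m0); rewrite addn0 mul1n.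
Qed.

(** With [M = m * n + m.-1], the factor [m.-1] of the closed form times [n.+1] is [M - n], which
    turns ['C(M, n)] over [M] into ['C(M.-1, n)]. *)
Lemma raney_pointed m n : 1 < m ->
  n.+1 * raney m n m.-1 = 'C(m.-2 + m * n, n).
Proof.
move=> m1; pose M := m * n + m.-1; have m0 : 0 < m by exact: ltnW.
have M0 : 0 < M by rewrite /M; nia.
have := raney_closed n m.-1 m0; rewrite -/M => e.
apply/eqP; rewrite -(eqn_pmul2r M0) -mulnA e mulnA.
have -> : m.-2 + m * n = M.-1 by rewrite /M; lia.
rewrite [X in _ == X]mulnC mul_bin_down; apply/eqP; congr (_ * _).
rewrite /M; case: m m1 {M M0 e m0} => [|[|m]] //= _; nia.
Qed.

(** The factor [m * (n - i)] will count positions of a diameter. Its part [n - i] is absorbed by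
    [raney_pointed]; what is left is a convolution. *)
Lemma raney_cyclic m n : 0 < m -> 0 < n ->
  \sum_(i < n) m * (n - i) * (raney m i 1 * raney m (n.-1 - i) m.-1) = 'C(m * n, n).
Proof.
move=> m0; case: n => // n _ /=.
suff e : \sum_(i < n.+1) (n.+1 - i) * (raney m i 1 * raney m (n - i) m.-1) =
    'C((m * n.+1).-1, n).
  apply/eqP; rewrite -(eqn_pmul2l (ltn0Sn n)) -mul_bin_diag -e mulnAC -mulnA.
  rewrite big_distrr /= mulnC big_distrl /= big_distrl /=; apply/eqP.
  by apply: eq_bigr => i _; lia.
(* The formula of [raney_pointed] involves [m - 2]. For [m = 1] only the last term of the sum is
   nonzero. *)
have [m1|m1] := leqP m 1.
  have -> : m = 1 by lia.
  rewrite [in RHS]mul1n binn big_ord_recr /= big1 => [|i _].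
    have r1 k : raney 1 k 1 = 1 by elim: k => // k IHk; rewrite raney1.
    by rewrite subnn subSnn add0n r1.
  by rewrite raney0; case: eqP => [|_]; [have := ltn_ord i; lia|rewrite !muln0].
rewrite (_ : (m * n.+1).-1 = (1 + m.-2) + m * n); last by lia.
rewrite -(@raney_convolution m (fun n y => 'C(y + m * n, n))); first last.
- by move=> k y; rewrite addSn binS; congr (_ + 'C(_, _)); lia.
- by move=> y; rewrite bin0.
apply: eq_bigr => i _; rewrite -raney_pointed // mulnCA; congr (_ * (_ * _)).
by rewrite subSn // -ltnS.
Qed.

End Raney.

(** * Noncrossing intervals *)

Section Intervals.
Local Open Scope nat_scope.
Context (m M : nat).
Hypothesis m_gt0 : 0 < m.
Local Notation V := ('I_M.+1 * 'I_M.+1)%type.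
Implicit Types (x y : V) (D : {set V}) (a b c i j k : nat).

Definition ival a b : V := (inord a, inord b).

Definition admissible x := (x.1 + m < x.2) && (m %| x.2 - x.1 - 1).

Definition crossing x y := [&& x.1 < y.1, y.1 < x.2 & x.2 < y.2].

(* [k] is the number of sides of a cell still to be read from left to right:
   only for [k = 0] may the whole of [a, b] be the next side. *)
Definition dissection a b k D : Prop :=
  [/\ forall x, x \in D -> [/\ admissible x, a <= x.1 & x.2 <= b],
      forall x y, x \in D -> y \in D -> ~~ crossing x y &
      0 < k -> forall x, x \in D -> ~ (x.1 = a :> nat /\ x.2 = b :> nat)].

Lemma ivalE a b : a <= M -> b <= M ->
  ((ival a b).1 = a :> nat) * ((ival a b).2 = b :> nat).
Proof. by move=> aM bM; rewrite /ival /= !inordK. Qed.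

Lemma eq_ival x a b : x.1 = a :> nat -> x.2 = b :> nat -> x = ival a b.
Proof.
case: x => [x1 x2] /= <- <-; rewrite /ival; congr (_, _);
  by apply/val_inj; rewrite /= inordK.
Qed.

Lemma admissibleP x : admissible x ->
  exists2 i, 0 < i & (x.2 : nat) = x.1 + m * i + 1.
Proof.
move=> /andP[lt_x /dvdnP[i xi]]; exists i; last by lia.
by case: i xi => // xi; lia.
Qed.

Lemma admissible_ival a i : 0 < i -> a + m * i + 1 <= M ->
  admissible (ival a (a + m * i + 1)).
Proof.
move=> i0 bM; have aM : a <= M by lia.
rewrite /admissible !ivalE // (_ : a + m * i + 1 - a - 1 = m * i); last by lia.
by rewrite dvdn_mulr // andbT; nia.
Qed.

(* The dissections whose next side, starting at [a], ends at [a + m * i + 1]. *)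
Definition fibre a b k j i : set {set V} := [set D | [/\ dissection a b k.+1 D,
  0 < i -> ival a (a + m * i + 1) \in D &
  forall i', i < i' -> i' <= j -> ival a (a + m * i' + 1) \notin D]].

(** One tree of the forest: a leaf for [i = 0], otherwise a root diagonal with the [m] subtrees read
    off from the cell below it. *)
Definition first_tree a i : set {set V} := if i == 0 then [set finset.set0] else
  setprod [set [set ival a (a + m * i + 1)]%SET]
          [set D | dissection a (a + m * i + 1) m D].

(** The first side is the longest candidate diagonal of [D] that starts at [a]; more diagonals can
    only lengthen it. *)
Lemma fibre_ordered a b k j i i' (D D' : {set V}) : i <= j ->
  fibre a b k j i D -> fibre a b k j i' D' -> D \subset D' -> i <= i'.
Proof.
move=> ij [_ Di _] [_ _ D'i'] DD'; rewrite leqNgt; apply/negP => i'i.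
have := D'i' i i'i ij; rewrite (fintype.subsetP DD') //; apply: Di; lia.
Qed.

Lemma fibre_cover a b k j :
  [set D | dissection a b k.+1 D] =
  [set D | exists2 i, i < j.+1 & fibre a b k j i D].
Proof.
rewrite eqEsubset; split=> D; last by move=> [i _ []].
move=> dD; pose P i := (i <= j) && ((i == 0) || (ival a (a + m * i + 1) \in D)).
have exP : exists i, P i by exists 0.
have leP i : P i -> i <= j by case/andP.
case: (ex_maxnP exP leP) => i /andP[ij Pi] imax; exists i => //; split=> //.
  by case: i Pi {ij imax} => //= i /orP[].
move=> i' ii' i'j; apply/negP => i'D.
by have := imax i'; rewrite /P i'j i'D orbT /= => /(_ isT); lia.
Qed.

Lemma fibre_split a k j i : k < m -> i <= j -> a + m * j + k + 2 <= M ->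
  fibre a (a + m * j + k + 2) k j i =
  setprod (first_tree a i) [set D | dissection (a + m * i + 1) (a + m * j + k + 2) k D].
Proof.
set b := a + m * j + k + 2; set c := a + m * i + 1 => km ij bM.
have cb : c < b by rewrite /b /c; nia.
rewrite eqEsubset; split=> D.
  move=> [[Dv Dnc Dab] Di Dmax].
  (* No diagonal passes over [c]: if it starts at [a] it would be a longer first side, and if it
     starts later it would cross the first side. *)
  have side x : x \in D -> (x.2 <= c) || (c <= x.1).
    move=> xD; have [vx ax xb] := Dv x xD; apply: contraT.
    rewrite negb_or -!ltnNge => /andP[cx2 x1c].
    have [i' i'0 x2] := admissibleP vx.
    have [ea|na] := eqVneq (x.1 : nat) a.
      have x2b : x.2 < b.
        rewrite ltn_neqAle xb andbT; apply/eqP => xb'.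
        exact: (Dab isT x xD).
      have i'j : i' <= j by move: x2b; rewrite x2 ea /b; nia.
      have ii' : i < i' by move: cx2; rewrite x2 ea /c; nia.
      have := Dmax i' ii' i'j; rewrite -(@eq_ival x) ?xD //.
      by rewrite x2 ea.
    have i0 : 0 < i by rewrite lt0n; apply/eqP => i0; move: x1c; rewrite /c i0; lia.
    have aM : a <= M by lia.
    have cM : c <= M by lia.
    have := Dnc _ _ (Di i0) xD.
    by rewrite /crossing !ivalE // -/c x1c cx2 andbT; lia.
  exists [set x in D | x.2 <= c]%SET, [set x in D | c <= x.1]%SET; split.
  - rewrite /first_tree; case: eqP => [i0|iN0] /=.
      apply/setP => x; rewrite !inE; apply/negP => /andP[xD].
      have [/andP[+ _] ax _] := Dv x xD; rewrite /c i0; lia.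
    have i0 : 0 < i by lia.
    have aM : a <= M by lia.
    have cM : c <= M by lia.
    exists [set ival a c]%SET, ([set x in D | x.2 <= c] :\ ival a c)%SET.
    split=> //.
      split.
      - by move=> x; rewrite !inE => /andP[_ /andP[xD xc]]; have [] := Dv x xD.
      - by move=> x y; rewrite !inE => /andP[_ /andP[xD _]] /andP[_ /andP[yD _]]; exact: Dnc.
      move=> _ x; rewrite !inE => /andP[/eqP xac _] [x1 x2].
      by apply: xac; exact: eq_ival.
    have iD := Di i0; rewrite finset.setD1K //.
    by rewrite inE iD /= (ivalE aM cM).2.
  - split.
    + by move=> x; rewrite !inE => /andP[xD xc]; have [] := Dv x xD.
    + by move=> x y; rewrite !inE => /andP[xD _] /andP[yD _]; exact: Dnc.
    (* The rest [[c, b]] has length [m * (j - i) + k + 1], hence is not an allowed diagonal when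
       [0 < k < m]. *)
    move=> k0 x; rewrite !inE => /andP[xD _] [x1 x2].
    have [vx _ _] := Dv x xD; have [i' i'0] := admissibleP vx.
    rewrite x1 x2 /c /b => e.
    have e' : k = m * (i' + i - j) by nia.
    have : m %| k by rewrite e' dvdn_mulr.
    by rewrite gtnNdvd.
  apply/setP => x; rewrite !inE -andb_orr.
  by have [/side ->|] := boolP (x \in D).
move=> [D1 [D2 [D1r [D2v D2nc _] ->]]].
have D1E : [/\ forall x, x \in D1 -> [/\ admissible x, a <= x.1 & x.2 <= c],
    forall x y, x \in D1 -> y \in D1 -> ~~ crossing x y &
    0 < i -> ival a c \in D1].
  move: D1r; rewrite /first_tree; case: eqP => [i0 ->|iN0].
    by split=> [x|x y|]; rewrite ?finset.in_set0 // i0.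
  have i0 : 0 < i by lia.
  have aM : a <= M by lia.
  have cM : c <= M by lia.
  move=> [_ [D' [-> [D'v D'nc _] ->]]]; rewrite -/c in D'v *; split.
  - move=> x; rewrite !inE => /predU1P[->|/D'v//].
    by rewrite !ivalE // leqnn leqnn; split=> //; exact: admissible_ival.
  - move=> x y; rewrite !inE => /predU1P[->|xD] /predU1P[->|yD]; last exact: D'nc.
    + by rewrite /crossing ltnn.
    + by have [_ ? ?] := D'v y yD; rewrite /crossing !ivalE //; lia.
    by have [_ ? ?] := D'v x xD; rewrite /crossing !ivalE //; lia.
  by rewrite !inE eqxx.
have [D1v D1nc D1i] := D1E.
have D1lt x : x \in D1 -> x.1 < x.2 by move=> /D1v[/andP[+ _] _ _]; lia.
have D2lt x : x \in D2 -> x.1 < x.2 by move=> /D2v[/andP[+ _] _ _]; lia.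
split.
- split.
  + move=> x; rewrite inE => /orP[/D1v[? ? ?]|/D2v[? ? ?]]; split=> //; lia.
  + move=> x y; rewrite !inE => /orP[xD|xD] /orP[yD|yD]; first exact: D1nc.
    * by have [_ _ ?] := D1v x xD; have [_ ? _] := D2v y yD; rewrite /crossing; lia.
    * have [_ _ ?] := D1v y yD; have [_ ? _] := D2v x xD.
      by have := D1lt y yD; rewrite /crossing; lia.
    exact: D2nc.
  move=> _ x; rewrite inE => /orP[/D1v[_ ? ?]|/D2v[_ ? ?]]; lia.
- by move=> i0; rewrite inE D1i.
move=> i' ii' i'j; rewrite inE negb_or.
have aM : a <= M by lia.
have i'M : a + m * i' + 1 <= M by nia.
apply/andP; split; apply/negP => xD.
  by have [_ _] := D1v _ xD; rewrite !ivalE // /c; nia.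
by have [_ + _] := D2v _ xD; rewrite !ivalE // /c; lia.
Qed.

End Intervals.

(** * Matchings on dissections *)

Section DissectionCount.
Local Open Scope nat_scope.
Context (m M : nat).
Hypothesis m_gt0 : 0 < m.
Local Notation V := ('I_M.+1 * 'I_M.+1)%type.
Local Notation ival := (ival M).
Implicit Types (x y : V) (D : {set V}) (a b c i j k : nat).

Lemma dissection_lt a b k D x : dissection m a b k D -> x \in D -> x.1 < x.2.
Proof. by move=> [Dv _ _] /Dv[/andP[+ _] _ _]; lia. Qed.

Lemma dissection_set0 a b k : dissection m a b k (finset.set0 : {set V}).
Proof. by split=> [x|x y|_ x]; rewrite finset.in_set0. Qed.

Lemma dissection_small a b k D : b <= a + m -> dissection m a b k D -> D = finset.set0.
Proof.
move=> ab [Dv _ _]; apply/setP => x; rewrite finset.in_set0; apply/negP => /Dv.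
by move=> [/andP[+ _]]; lia.
Qed.

Lemma dissection_root a b D : a <= M -> b <= M -> admissible m (ival a b) ->
  dissection m a b 1 D -> dissection m a b 0 (ival a b |: D).
Proof.
move=> aM bM ab [Dv Dnc _]; have [e1 e2] := ivalE aM bM; split=> //.
  move=> x; rewrite !inE => /predU1P[->|/Dv//].
  by rewrite e1 e2 !leqnn.
move=> x y; rewrite !inE => /predU1P[->|xD] /predU1P[->|yD]; last exact: Dnc.
- by rewrite /crossing ltnn.
- by have [_ ? ?] := Dv y yD; rewrite /crossing e1 e2; lia.
by have [_ ? ?] := Dv x xD; rewrite /crossing e1 e2; lia.
Qed.

Lemma dissection_unroot a b k D : dissection m a b 0 D ->
  dissection m a b k (D :\ ival a b).
Proof.
move=> [Dv Dnc _]; split.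
- by move=> x; rewrite !inE => /andP[_ /Dv].
- by move=> x y; rewrite !inE => /andP[_ xD] /andP[_ yD]; exact: Dnc.
by move=> _ x; rewrite !inE => /andP[/eqP xab _] [x1 x2]; apply: xab; exact: eq_ival.
Qed.

Lemma first_tree_le a i D x : a + m * i + 1 <= M -> first_tree m a i D -> x \in D ->
  x.2 <= a + m * i + 1.
Proof.
move=> iM; rewrite /first_tree; case: eqP => [_ ->|_]; first by rewrite finset.in_set0.
move=> [_ [D' [-> [D'v _ _] ->]]]; rewrite !inE => /predU1P[->|/D'v[]//].
by rewrite (ivalE _ _).2 //; lia.
Qed.

Lemma fibre_side a j k i D x : k < m -> i <= j -> a + m * j + k + 2 <= M ->
  fibre m a (a + m * j + k + 2) k j i D -> x \in D ->
  x.2 <= a + m * i + 1 \/ a + m * i + 1 <= x.1.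
Proof.
move=> km ij jM; rewrite fibre_split // => -[D1 [D2 [D1r [D2v _ _] ->]]].
rewrite inE => /orP[xD|/D2v[_ ? _]]; [left|by right].
apply: first_tree_le xD => //; nia.
Qed.

Definition dissection_good_upto l := forall a j k, m * j + k < l -> k <= m ->
  a + m * j + k + 1 <= M ->
  crit_matched j [set D : {set V} | dissection m a (a + m * j + k + 1) k D] (raney m j k).

Lemma crit_matched_first_tree a i : a + m * i + 1 <= M -> dissection_good_upto (m * i).+1 ->
  crit_matched i (@first_tree m M a i) (raney m i 1).
Proof.
move=> iM IH; rewrite /first_tree; case: eqP => [->|iN0].
  by rewrite -{1}(@cards0 V); exact: crit_matched_set1.
case: i iN0 iM IH => // i _ iM IH; rewrite raney1 -[raney m i m]mul1n -[X in crit_matched X]add1n.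
have e : a + m * i.+1 + 1 = a + m * i + m + 1 by lia.
rewrite e in iM *; set r := ival a _.
apply: (@crit_matched_product _ [set r]%SET (~: [set r])%SET).
- by move=> x; rewrite !inE negbK.
- by rewrite -{1}(cards1 r); exact: crit_matched_set1.
- by move=> s ->.
- by apply: IH; lia.
move=> s [sv _ sN]; apply/fintype.subsetP => x xs; rewrite !inE; apply/eqP => xr.
have aM : a <= M by lia.
by apply: (sN m_gt0 x xs); rewrite xr /r !ivalE.
Qed.

Lemma crit_matched_fibre a j k i : k < m -> i <= j -> a + m * j + k + 2 <= M ->
  dissection_good_upto (m * j + k.+1) ->
  crit_matched j (@fibre m M a (a + m * j + k + 2) k j i) (raney m i 1 * raney m (j - i) k).
Proof.
move=> km ij jM IH; rewrite fibre_split // -{1}(subnKC ij).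
set c := a + m * i + 1.
have cM : c <= M by rewrite /c; nia.
apply: (@crit_matched_product _ [set x : V | x.2 <= c]%SET [set x : V | (c <= x.1) && (x.1 < x.2)]%SET).
- by move=> x; rewrite !inE; lia.
- apply: crit_matched_first_tree => // a' j' k' l km' jM'; apply: IH => //.
  by have := leq_mul2l m i j; rewrite ij orbT; lia.
- by move=> s rs; apply/fintype.subsetP => x xs; rewrite inE; exact: first_tree_le xs.
- have -> : a + m * j + k + 2 = c + m * (j - i) + k + 1 by rewrite /c; nia.
  by apply: IH; [have := leq_mul2l m (j - i) j; lia|lia|rewrite /c; nia].
move=> s ds; apply/fintype.subsetP => x xs; rewrite inE (dissection_lt ds xs) andbT.
by have [dv _ _] := ds; have [] := dv x xs.
Qed.

(** Reading one side splits off one tree, whence a convolution. Once [m] sides are read, [k = 0] and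
    the remaining interval is toggled, unless it is a side of the polygon ([j = 0]); this is the
    value [(j == 0)] of [raney m j 0]. *)
Lemma crit_matched_dissection a j k : k <= m -> a + m * j + k + 1 <= M ->
  crit_matched j [set D : {set V} | dissection m a (a + m * j + k + 1) k D] (raney m j k).
Proof.
suff IH l : dissection_good_upto l by apply: (IH (m * j + k).+1).
elim: l => [//|l IH] {}a {}j {}k; rewrite ltnS leq_eqVlt => /predU1P[l_jk|]; last exact: IH.
have pos a' j' k' : m * j' + k'.+1 = l -> k' < m -> a' + m * j' + k'.+1 + 1 <= M ->
    crit_matched j' [set D : {set V} | dissection m a' (a' + m * j' + k'.+1 + 1) k'.+1 D] (raney m j' k'.+1).
  move=> l' km jM; have e : a' + m * j' + k'.+1 + 1 = a' + m * j' + k' + 2 by lia.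
  rewrite e (@fibre_cover m M m_gt0 _ _ _ j') -[X in raney _ _ X]add1n -(@raney_convolution m (raney m)) //; last first.
    by move=> *; exact: raneyS.
  pose Q i : set {set V} := [set D | (i <= j') /\ fibre m a' (a' + m * j' + k' + 2) k' j' i D].
  have -> : [set D : {set V} | exists2 i, i < j'.+1 & fibre m a' (a' + m * j' + k' + 2) k' j' i D] =
      [set D | exists2 i, i < j'.+1 & Q i D].
    by rewrite eqEsubset; split=> D [i ij]; [exists i|move=> [_ ?]; exists i].
  apply: (@crit_matched_bigcup _ Q _ (fun i => raney m i 1 * raney m (j' - i) k')) => [i ij|i i' s t [ij si] [_ s't]]; last exact: fibre_ordered si s't.
  have -> : Q i = fibre m a' (a' + m * j' + k' + 2) k' j' i.
    by rewrite eqEsubset; split=> D; [case|].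
  by apply: crit_matched_fibre => //; [lia|rewrite l'].
case: k l_jk => [|k] l_jk km jM; last exact: pos.
case: j l_jk jM => [|j] l_jk jM.
  have -> : [set D : {set V} | dissection m a (a + m * 0 + 0 + 1) 0 D] = [set finset.set0].
    rewrite eqEsubset; split=> D /= => [|->]; last exact: dissection_set0.
    by apply: dissection_small; lia.
  by rewrite -{1}(@cards0 V); exact: crit_matched_set1.
rewrite raney0 /=; set b := a + m * j.+1 + 0 + 1.
have aM : a <= M by lia.
have bM : b <= M by [].
have vab : admissible m (ival a b).
  by rewrite /b addn0; apply: admissible_ival; lia.
(* Removing [[a, b]] leaves a dissection with [k = m]. Its size bound comes from [pos], which is
   already available at this same length. *)
have [bound _] : crit_matched j [set D : {set V} | dissection m a b m D] (raney m j m).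
  have -> : b = a + m * j + m + 1 by rewrite /b; lia.
  by have := pos a j m.-1; rewrite (prednK m_gt0); apply; lia.
apply: (@crit_matched_toggle _ _ _ (ival a b)) => [D dD|D rD].
  rewrite (cardsD1 (ival a b)) -[j.+1]add1n leq_add ?leq_b1 //.
  exact/bound/dissection_unroot.
split=> dD; last first.
  by rewrite -(finset.setU1K rD); exact: dissection_unroot.
apply: dissection_root => //; have [Dv Dnc _] := dD; split=> // _ x xD [x1 x2].
by move: rD; rewrite -(eq_ival x1 x2) xD.
Qed.

Section Rooted.
Context (n : nat).
Hypothesis n_gt0 : 0 < n.
Local Notation L := (m * n + 1).
Hypothesis LM : L <= M.
Local Notation r := (ival 0 L).

(* For type B: the pair (0, L) stands for the diameter at [a], and [t] for
   the diameter at [a + t]. *)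
Definition rooted a : set {set V} := [set D | dissection m 0 L 0 D /\
  (r \in D \/ forall t, 0 < t -> a + t < L -> exists2 x, x \in D & x.1 < t < x.2)].

Let L_eq : 0 + m * n.-1 + m.-1 + 2 = L.
Proof. by case: n n_gt0 => // n' _; rewrite /= mulnS; lia. Qed.

Let fib i : set {set V} := fibre m 0 L m.-1 n.-1 i.

Let crit_matched_fib i : i < n -> crit_matched n.-1 (fib i) (raney m i 1 * raney m (n.-1 - i) m.-1).
Proof.
move=> ltin; rewrite /fib -L_eq; apply: crit_matched_fibre; rewrite ?L_eq //; try lia.
by move=> a' j' k' _ km jM; exact: crit_matched_dissection.
Qed.

Let fib_cover D : dissection m 0 L 0 D -> exists2 i, i < n & fib i (D :\ r).
Proof.
move=> /(dissection_unroot m) dD.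
have : [set D : {set V} | dissection m 0 L m.-1.+1 D] (D :\ r).
  by rewrite /= (prednK m_gt0).
by rewrite (@fibre_cover m M m_gt0 _ _ _ n.-1) (prednK n_gt0).
Qed.

Let fib_side i D x : i < n -> fib i D -> x \in D -> x.2 <= m * i + 1 \/ m * i + 1 <= x.1.
Proof.
move=> ltin; rewrite /fib -{1}L_eq => /fibre_side h /h; rewrite add0n; apply; rewrite ?L_eq //; lia.
Qed.

(** No diagonal of [D] passes over the end [m * i + 1] of the first side, whereas the first side
    passes over all that precedes it. So every later diameter is blocked exactly when the one at
    that end is no longer below [L]. *)
Let fib_cond a i D : i < n -> fib i D ->
  (forall t, 0 < t -> a + t < L -> exists2 x, x \in D & x.1 < t < x.2) <-> L <= a + (m * i + 1).
Proof.
move=> ltin fD; split=> [h|Lai t t0 atL].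
  rewrite leqNgt; apply/negP => /(h _ (ltn_addl _ (ltn0Sn 0))) [x xD /andP[x1 x2]].
  by have [] := fib_side ltin fD xD; rewrite leqNgt ?x1 ?x2.
have [_ Di _] := fD; have i0 : 0 < i by rewrite lt0n; apply/eqP => i_0; move: Lai; rewrite i_0; lia.
exists (ival 0 (0 + m * i + 1)); first exact: Di.
have iM : 0 + m * i + 1 <= M by nia.
rewrite (ivalE (leq0n M) iM).1 (ivalE (leq0n M) iM).2.
by rewrite t0 add0n -(ltn_add2l a) (leq_trans atL).
Qed.

(** By [fib_cond], if [a < m * (n - i)] some later diameter is not blocked, so [r] must be present
    and is joined to the critical sets of the fibre. Otherwise [r] is optional and toggling it
    leaves nothing critical. *)
Lemma crit_matched_rooted a :
  crit_matched n (rooted a) (\sum_(i < n) (a < m * (n - i)) * (raney m i 1 * raney m (n.-1 - i) m.-1)).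
Proof.
pose Q i : set {set V} := [set D | [/\ i < n, rooted a D & fib i (D :\ r)]].
have -> : rooted a = [set D | exists2 i, i < n & Q i D].
  rewrite eqEsubset; split=> D; last by move=> [i _ []].
  by move=> aD; have [i ltin iD] := fib_cover aD.1; exists i.
apply: (@crit_matched_bigcup _ Q _ (fun i => (a < m * (n - i)) *
    (raney m i 1 * raney m (n.-1 - i) m.-1))) => [i ltin|i i' s t [ltin _ si] [_ _ s't] st]; last first.
  have ij : i <= n.-1 by lia.
  apply: (fibre_ordered m_gt0 ij si s't); exact: finset.setSD.
have rN D : fib i D -> r \notin D.
  move=> [[_ _ Dr] _ _]; apply/negP => rD.
  by apply: (Dr isT _ rD); rewrite !ivalE; lia.
have vr : admissible m r by rewrite -[m * n]add0n; apply: admissible_ival; lia.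
have [lt_a|le_a] := ltnP a (m * (n - i)).
  have -> : Q i = setprod [set [set r]%SET] (fib i).
    rewrite eqEsubset; split=> D.
      move=> [_ [dD [rD|cD]] iD].
        by exists [set r]%SET, (D :\ r); split=> //; rewrite finset.setD1K.
      have [rD|rD] := boolP (r \in D).
        by exists [set r]%SET, (D :\ r); split=> //; rewrite finset.setD1K.
      have Dr : D :\ r = D.
        by apply/setP => x; rewrite !inE; case: eqP => // ->; rewrite (negbTE rD).
      rewrite Dr in iD; have := (fib_cond a ltin iD).1 cD.
      by have := mulnBr m n i; nia.
    move=> [_ [D' [-> iD' ->]]]; have rD' := rN _ iD'; split=> //; last by rewrite finset.setU1K.
    have [dD' _ _] := iD'; split; last by left; rewrite finset.setU11.
    exact: dissection_root.
  rewrite mul1n -[raney m i 1 * _]mul1n -(prednK n_gt0) -[X in crit_matched X]add1n prednK //.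
  apply: (@crit_matched_product _ [set r]%SET (~: [set r])%SET).
  - by move=> x; rewrite !inE negbK.
  - by rewrite -{1}(cards1 r); exact: crit_matched_set1.
  - by move=> s ->.
  - exact: crit_matched_fib.
  move=> s /rN rs; apply/fintype.subsetP => x xs; rewrite !inE.
  by apply: contraTneq xs => ->.
rewrite mul0n; apply: (@crit_matched_toggle _ _ _ r) => [D [_ _ iD]|D rD].
  have [bound _] := crit_matched_fib ltin.
  by have := leq_add (leq_b1 (r \in D)) (bound _ iD); rewrite -cardsD1 add1n prednK.
have Dr : D :\ r = D.
  by apply/setP => x; rewrite !inE; case: eqP => // ->; rewrite (negbTE rD).
have rDr : (r |: D) :\ r = D by rewrite finset.setU1K.
split=> -[_ [dD cD] iD]; split=> //.
- split; last by left; rewrite finset.setU11.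
  apply: dissection_root => //.
  by rewrite Dr in iD; have [[? ? h] _ _] := iD; split=> // _; exact: h.
- by rewrite rDr -Dr.
- split; first by rewrite -rDr; exact: dissection_unroot.
  right; rewrite rDr in iD; apply/(fib_cond a ltin iD).
  by have := mulnBr m n i; nia.
by rewrite Dr -rDr.
Qed.

End Rooted.

End DissectionCount.

(** * Crossing diagonals of a convex polygon *)

Section Convex.
Context (R : realType) (N : nat) (P : 'I_N -> 'rV[R]_2).
Hypothesis convexP : convex_polygon P.
Local Notation ori a b c := (orientation (P a) (P b) (P c)).
Implicit Types (a b c d : 'I_N).

Lemma orientation_rot a b c : (ori a b c) = (ori b c a).
Proof. by rewrite /orientation; ring. Qed.

Lemma orientation_swap a b c : (ori a b c) = - (ori b a c).
Proof. by rewrite /orientation; ring. Qed.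

Lemma val_ordS a : (a.+1 < N)%N -> ordS a = a.+1 :> nat.
Proof. by move=> aN; rewrite /= modn_small. Qed.

(* The vertices after [a + 1] lie in the open half-plane to the left of the
   side from [a] to [a + 1], where turning left as seen from [a] is
   transitive. *)
Lemma orientation_gt0 a b c : (a < b < c)%N -> 0 < (ori a b c).
Proof.
have [n] := ubnP (c - b)%N; elim: n b c => // n IH b c; rewrite ltnS => cbn.
move=> /andP[ab bc].
have aN : (a.+1 < N)%N by apply: leq_ltn_trans ab _.
have side d : (a.+1 < d)%N -> 0 < (ori a (ordS a) d).
  move=> ad; apply: convexP; rewrite -val_eqE /= ?modn_small //; lia.
have [b1|b1] := eqVneq (b : nat) a.+1.
  have -> : b = ordS a by apply/val_inj; rewrite /= modn_small.
  by apply: side; rewrite -b1.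
have bN : (b.+1 < N)%N by apply: leq_ltn_trans bc _.
have vb := val_ordS bN; have va := val_ordS aN.
have edge : 0 < (ori a b (ordS b)).
  by rewrite orientation_rot; apply: convexP; rewrite -val_eqE /= ?modn_small //; lia.
have [c1|c1] := eqVneq (c : nat) b.+1.
  by have -> : c = ordS b by apply/val_inj; rewrite /= c1 modn_small.
have IHc : 0 < (ori a (ordS b) c) by apply: IH; rewrite vb; lia.
have sb : 0 < (ori a (ordS a) b) by apply: side; lia.
have sc : 0 < (ori a (ordS a) c) by apply: side; lia.
have sd : 0 < (ori a (ordS a) (ordS b)) by apply: side; rewrite vb; lia.
have e : (ori a (ordS a) (ordS b)) * (ori a b c) =
    (ori a (ordS a) b) * (ori a (ordS b) c) + (ori a (ordS a) c) * (ori a b (ordS b)).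
  by rewrite /orientation; ring.
by rewrite -(pmulr_rgt0 _ sd) e addr_gt0 // mulr_gt0.
Qed.

Lemma relative_interior2 a b x : a != b -> relative_interior P [set a; b]%SET x <->
  exists2 t, 0 < t < 1 & x = (1 - t) *: P a + t *: P b.
Proof.
move=> ab; split=> [[c [d [t [e cd t01 ->]]]]|[t t01 ->]]; last by exists a, b, t.
have [ca da] : c \in [set a; b]%SET /\ d \in [set a; b]%SET.
  by rewrite e !inE !eqxx orbT.
move: ca da cd; rewrite !inE => /orP[] /eqP -> /orP[] /eqP ->; rewrite ?eqxx // => _.
  by exists t.
exists (1 - t); first by case/andP: t01 => t0 t1; rewrite subr_gt0 t1 gtrBl.
by rewrite addrC; congr (_ *: _ + _); ring.
Qed.

Lemma orientation_convex a b c d t :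
  orientation (P a) (P b) ((1 - t) *: P c + t *: P d) =
  (1 - t) * (ori a b c) + t * (ori a b d).
Proof. by rewrite /orientation !mxE; ring. Qed.

Lemma orientation_chord a b c : (a < b)%N ->
  [/\ (a < c < b)%N -> (ori a b c) < 0, c = a \/ c = b -> (ori a b c) = 0 &
      (c < a)%N || (b < c)%N -> 0 < (ori a b c)].
Proof.
move=> ab; split=> [/andP[ac cb]|[->|->]|/orP[ca|bc]].
- by rewrite orientation_rot orientation_swap -orientation_rot oppr_lt0 orientation_gt0 ?ac.
- by rewrite /orientation; ring.
- by rewrite /orientation; ring.
- by rewrite -orientation_rot orientation_gt0 ?ca.
- by rewrite orientation_gt0 ?ab.
Qed.

(** Cramer's rule: [t] and [u] are ratios of areas, and [D] computes the area of the quadrilateral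
    by splitting it along either diagonal. *)
Lemma cross_interleaved a b c d : (a < c)%N -> (c < b)%N -> (b < d)%N ->
  cross P [set a; b]%SET [set c; d]%SET.
Proof.
move=> ac cb bd.
have f1 : 0 < (ori a c d) by apply: orientation_gt0; rewrite ac (ltn_trans cb bd).
have f2 : 0 < (ori c b d) by apply: orientation_gt0; rewrite cb.
have g1 : 0 < (ori a c b) by apply: orientation_gt0; rewrite ac.
have g2 : 0 < (ori a b d) by apply: orientation_gt0; rewrite (ltn_trans ac cb).
have D : (ori a c d) + (ori c b d) = (ori a c b) + (ori a b d).
  by rewrite /orientation; ring.
have D0 : 0 < (ori a c d) + (ori c b d) by rewrite addr_gt0.
pose t := (ori a c d) / ((ori a c d) + (ori c b d)).
pose u := (ori a c b) / ((ori a c d) + (ori c b d)).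
exists ((1 - t) *: P a + t *: P b); split.
  apply/relative_interior2; first by rewrite -val_eqE /=; lia.
  by exists t => //; rewrite divr_gt0 //= ltr_pdivrMr // mul1r ltrDl.
apply/relative_interior2; first by rewrite -val_eqE /=; lia.
exists u; first by rewrite divr_gt0 //= ltr_pdivrMr // mul1r D ltrDl.
have {}D0 := lt0r_neq0 D0; rewrite /t /u; move: D0; rewrite /orientation => D0.
by apply/rowP => i; rewrite !mxE; have [->|->] : i = ord0 \/ i = ord_max;
  [case: i => -[|[|//]] ?; [left|right]; exact/val_inj|field|field].
Qed.

(** At a common point [f0] writes [0] as a positive combination of the orientations of [c] and [d],
    so these lie strictly on opposite sides of the line [ab] or both on it. The third case is there
    because a diagonal meets itself. *)
Lemma crossP a b c d : (a < b)%N -> (c < d)%N ->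
  cross P [set a; b]%SET [set c; d]%SET <->
  [\/ [/\ (a < c)%N, (c < b)%N & (b < d)%N],
      [/\ (c < a)%N, (a < d)%N & (d < b)%N] | a = c /\ b = d].
Proof.
move=> ab cd; split=> [[x []]|[[ac cb bd]|[ca ad db]|[<- <-]]]; last first.
- have mid : relative_interior P [set a; b]%SET (2^-1 *: P a + 2^-1 *: P b).
    apply/relative_interior2; first by rewrite -val_eqE /=; lia.
    by exists 2^-1; [apply/andP; split; lra|congr (_ *: _ + _); lra].
  by exists (2^-1 *: P a + 2^-1 *: P b).
- have [x [xc xa]] := cross_interleaved ca ad db; by exists x.
- exact: cross_interleaved.
move=> /relative_interior2 xab /relative_interior2 xcd.
have [|t t01 xt] := xab; first by rewrite -val_eqE /=; lia.
have [|u /andP[u0 u1] xu] := xcd; first by rewrite -val_eqE /=; lia.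
have f0 : (1 - u) * (ori a b c) + u * (ori a b d) = 0.
  rewrite -orientation_convex -xu xt /orientation !mxE; ring.
have u1' : 0 < 1 - u by rewrite subr_gt0.
have [cneg czero cpos] := orientation_chord c ab.
have [dneg dzero dpos] := orientation_chord d ab.
have tri (e : 'I_N) : [\/ (a < e < b)%N, e = a \/ e = b | (e < a)%N || (b < e)%N].
  have [->|ea] := eqVneq e a; first by constructor 2; left.
  have [->|eb] := eqVneq e b; first by constructor 2; right.
  move: ea eb; rewrite -!val_eqE /= => ea eb.
  have [ae|ae] := leqP a e; last by constructor 3.
  have [be|be] := leqP b e; first by constructor 3; lia.
  by constructor 1; lia.
have same A B : (1 - u) * A + u * B = 0 ->
    [/\ A < 0 -> B <= 0 -> False, A <= 0 -> B < 0 -> False,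
        0 < A -> 0 <= B -> False & 0 <= A -> 0 < B -> False].
  by move=> AB; split=> hA hB; nra.
have [s1 s2 s3 s4] := same _ _ f0.
case: (tri c) => hc; case: (tri d) => hd.
- by case: (s1 (cneg hc)); apply: ltW; exact: dneg.
- by case: (s1 (cneg hc)); rewrite dzero.
- by constructor 1; clear -ab cd hc hd; split; lia.
- by case: (s2 _ (dneg hd)); rewrite czero.
- move: cd; case: hc => ->; case: hd => ->; rewrite ?ltnn // => h.
    by constructor 3.
  by have := ltn_trans ab h; rewrite ltnn.
- by case: (s4 _ (dpos hd)); rewrite czero.
- by constructor 2; clear -ab cd hc hd; split; lia.
- by case: (s3 (cpos hc)); rewrite dzero.
by case: (s3 (cpos hc)); apply: ltW; exact: dpos.
Qed.

End Convex.

(** * Cyclic labels *)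

Lemma set2_eq (T : finType) (a b c d : T) : [set a; b]%SET = [set c; d]%SET ->
  (a = c /\ b = d) \/ (a = d /\ b = c).
Proof.
move=> e; have mem x : (x == a) || (x == b) = (x == c) || (x == d).
  by have /setP/(_ x) := e; rewrite !inE.
have := mem a; have := mem b; have := mem c; have := mem d; rewrite !eqxx ?orbT /=.
rewrite (eq_sym d a) (eq_sym d b) (eq_sym c a) (eq_sym c b).
have [->|ac] := eqVneq a c; have [->|bd] := eqVneq b d; try by left.
- have [->|bc] := eqVneq b c => //=.
  by have [->|cd] := eqVneq c d => //= _ _ _ _; left.
- have [->|ad] := eqVneq a d => //=.
  by have [->|cd] := eqVneq d c => //= _ _ _ _; left.
have [->|ad] := eqVneq a d => //=.
by have [->|bc] := eqVneq b c => //=; right.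
Qed.

Section Cyclic.
Context (N' : nat).
Local Notation N := N'.+1.
Implicit Types (p q c : 'I_N).

Definition residue (k : nat) : 'I_N := inord (k %% N).

Lemma val_residue k : (k < 2 * N)%N -> residue k = (if (k < N)%N then k else (k - N)%N) :> nat.
Proof.
move=> kN; rewrite /residue inordK ?ltn_pmod //; case: ltnP => [/modn_small//|Nk].
by rewrite -{1}(subnK Nk) modnDr modn_small //; lia.
Qed.

Lemma residue_val p : residue p = p.
Proof. by apply/val_inj; rewrite /residue /= inordK ?ltn_pmod // modn_small. Qed.

Lemma residue_period k : residue (k + N) = residue k.
Proof. by rewrite /residue modnDr. Qed.

Lemma ordS_residue k : ordS (residue k) = residue k.+1.
Proof.
apply/val_inj; rewrite /residue /= !inordK ?ltn_pmod //.
by rewrite -addn1 modnDml addn1.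
Qed.

Lemma iter_ordS_residue j k : iter j (@ordS _) (residue k) = residue (k + j).
Proof. by elim: j => [|j IH] /=; rewrite ?addn0 // IH ordS_residue addnS. Qed.

Lemma residue_inj a u v : (u < N)%N -> (v < N)%N -> residue (a + u) = residue (a + v) -> u = v.
Proof.
move=> uN vN /(congr1 val); rewrite /residue /= !inordK ?ltn_pmod // => /eqP.
by rewrite eqn_modDl !modn_small // => /eqP.
Qed.

Lemma boundary_distE p q :
  boundary_dist p q = (if (p <= q)%N then (q - p)%N else (q + N - p)%N).
Proof.
rewrite /boundary_dist; have pN := ltn_ord p; have qN := ltn_ord q.
have [pq|pq] := leqP p q; first by rewrite -addnBAC // modnDr modn_small //; lia.
by rewrite modn_small //; lia.
Qed.

Lemma boundary_dist_residue k l : (l < N)%N -> boundary_dist (residue k) (residue (k + l)) = l.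
Proof.
move=> lN; have kN : (k %% N < N)%N by rewrite ltn_pmod.
have -> : residue (k + l) = residue (k %% N + l) by rewrite /residue modnDml.
have -> : residue k = residue (k %% N) by rewrite /residue modn_mod.
move: (k %% N)%N kN => r rN; rewrite boundary_distE !val_residue; try lia.
rewrite rN; have [h|h] := ltnP (r + l) N; first by rewrite leq_addr addKn.
by have [h'|h'] := leqP r (r + l - N); lia.
Qed.

Lemma residue_boundary_dist p q : residue (p + boundary_dist p q) = q.
Proof.
apply/val_inj; rewrite /= boundary_distE; have pN := ltn_ord p; have qN := ltn_ord q.
have [pq|pq] := leqP p q; rewrite val_residue; try lia.
  by rewrite subnKC // qN.
by have [h|h] := ltnP (p + (q + N - p)) N; lia.
Qed.

Lemma boundary_dist_lt p q : (boundary_dist p q < N)%N.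
Proof. exact: ltn_pmod. Qed.

Lemma card_boundary_arc p q : #|boundary_arc p q| = (boundary_dist p q).+1.
Proof.
set d := boundary_dist p q; have dN : (d < N)%N := boundary_dist_lt p q.
have -> : boundary_arc p q = [set residue (p + k) | k : 'I_d.+1 in 'I_d.+1]%SET.
  apply/setP => c; rewrite inE -/d; apply/idP/imsetP => [cd|[k _ ->]].
    by exists (Ordinal (cd : (boundary_dist p c < d.+1)%N)); rewrite //= residue_boundary_dist.
  have := boundary_dist_residue p (leq_trans (ltn_ord k) dN).
  by rewrite residue_val => ->; rewrite -ltnS.
rewrite card_imset ?card_ord // => k l /residue_inj e; apply/val_inj; apply: e.
  exact: leq_trans (ltn_ord k) dN.
exact: leq_trans (ltn_ord l) dN.
Qed.

Section Rotate.
Context (R : realType) (P : 'I_N -> 'rV[R]_2).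
Hypothesis convexP : convex_polygon P.

Lemma convex_rotate a : convex_polygon (fun u : 'I_N => P (residue (a + u))).
Proof.
move=> u c cu cSu.
have e : residue (a + ordS u) = ordS (residue (a + u)).
  by rewrite ordS_residue /residue /= modnDmr addnS.
rewrite e; apply: convexP.
  by apply: contra_neq cu => /residue_inj h; apply/val_inj/h; exact: ltn_ord.
by rewrite -e; apply: contra_neq cSu => /residue_inj h; apply/val_inj/h; exact: ltn_ord.
Qed.

Lemma cross_residue a (u v u' v' : nat) : (u < v < N)%N -> (u' < v' < N)%N ->
  cross P [set residue (a + u); residue (a + v)]%SET [set residue (a + u'); residue (a + v')]%SET <->
  [\/ (u < u')%N /\ (u' < v < v')%N, (u' < u)%N /\ (u < v' < v)%N | u = u' /\ v = v'].
Proof.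
move=> /andP[uv vN] /andP[uv' vN'].
have uN := ltn_trans uv vN; have uN' := ltn_trans uv' vN'.
pose Q (i : 'I_N) := P (residue (a + i)).
have int i j : (i < j)%N -> forall jN : (j < N)%N, forall x,
    relative_interior P [set residue (a + i); residue (a + j)]%SET x <->
    relative_interior Q [set inord i; inord j]%SET x.
  move=> ij jN x; have iN := ltn_trans ij jN.
  rewrite !relative_interior2; first by rewrite /Q !inordK.
    by apply/eqP => /(congr1 val); rewrite /= !inordK //; lia.
  by apply/eqP => /(residue_inj iN jN); lia.
have -> : cross P [set residue (a + u); residue (a + v)]%SET [set residue (a + u'); residue (a + v')]%SET <->
    cross Q [set inord u; inord v]%SET [set inord u'; inord v']%SET.
  by split=> -[x [h1 h2]]; exists x; split; (exact/(int _ _ uv vN) || exact/(int _ _ uv' vN')).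
rewrite (crossP (convex_rotate a)) ?inordK //; split=> -[].
- by move=> [h1 h2 h3]; constructor 1; lia.
- by move=> [h1 h2 h3]; constructor 2; lia.
- move=> [/(congr1 val) /= + /(congr1 val) /=]; rewrite !inordK // => -> ->.
  by constructor 3.
- by move=> [h1 h2]; constructor 1; split; lia.
- by move=> [h1 h2]; constructor 2; split; lia.
by move=> [-> ->]; constructor 3.
Qed.

End Rotate.

End Cyclic.

(** * Type A *)

Lemma homotopy_equivalent_empty (R : realType) (X Y : topologicalType) :
  (X -> False) -> (Y -> False) -> homotopy_equivalent R X Y.
Proof.
move=> X0 Y0; exists (fun x => False_rect Y (X0 x)), (fun y => False_rect X (Y0 y)).
split; try by [move=> x; case: (X0 x)|move=> y; case: (Y0 y)].
  exists (fun xt => xt.1); split; try by move=> x; case: (X0 x).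
  by apply: continuous_subspaceT => xt; case: (X0 xt.1).
exists (fun yt => yt.1); split; try by move=> y; case: (Y0 y).
by apply: continuous_subspaceT => yt; case: (Y0 yt.1).
Qed.

(** Critical sets are facets because they have the largest possible size. For [d = 0] the only face
    is empty, whereas supports of points are not, so both spaces are empty. *)
Lemma crit_matched_wedge (R : realType) (V : finType) (K : simplicial_complex V) (d k : nat) :
  crit_matched d (faces K) k -> (0 < k)%N -> (d = 0%N -> k = 1%N) ->
  homotopic_to_wedge_of_spheres R (realization R K) k d.
Proof.
move=> [Kd [S [mS <- Sd]]] S0 d0; case: d => [|d] in Kd Sd d0 *.
  split; first exact: d0.
  apply: homotopy_equivalent_empty => -[x /set_mem].
    move=> [_ x1 /Kd]; rewrite leqn0 cards_eq0 => /eqP sx.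
    by have := support_neq0 x1; rewrite /support sx eqxx.
  by rewrite /unit_sphere /= big_ord0 => /esym/eqP; rewrite oner_eq0.
apply: wedge_of_spheres => //.
- exact: matched_uniq mS.
- by move=> s sS; split; [exact: matched_sub sS|exact: Sd].
- move=> s t sS Kt st; apply/esym/eqP.
  by rewrite eqEcard st (Sd s sS) Kd.
exact: matched_noncritical.
Qed.

Section TypeA.
Context (R : realType) (m n : nat) (P : 'I_(m * n).+2 -> 'rV[R]_2).
Hypothesis (m_gt0 : (0 < m)%N) (n_gt0 : (0 < n)%N) (convexP : convex_polygon P).
Local Notation I := 'I_(m * n).+2.
Local Notation L := (m * n).+1.
Implicit Types (x y : I * I).

Definition chord x : {set I} := [set x.1; x.2]%SET.

Lemma chord_inj : {in [set x : I * I | (x.1 < x.2)%N]%SET &, injective chord}.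
Proof.
move=> [x1 x2] [y1 y2]; rewrite !inE /chord /= => x12 y12 /set2_eq [[-> ->]//|[e1 e2]].
by move: y12; rewrite -e1 -e2 => ?; lia.
Qed.

Lemma vertexA_chord x : admissible m x -> ~ (x.1 = 0%N :> nat /\ x.2 = L :> nat) ->
  vertexA (chord x).
Proof.
case: x => a b; rewrite /admissible /= => /andP[mb /dvdnP[j ej]] nab.
have bN := ltn_ord b; have ab : (a < b)%N by lia.
have j0 : (0 < j)%N by case: j ej => // ej; lia.
have jn : (j < n)%N.
  rewrite ltn_neqAle; apply/andP; split; last by rewrite -(leq_pmul2l m_gt0); lia.
  apply/eqP => jn; apply: nab; rewrite jn in ej; split; lia.
exists a, b, j; split=> //.
- have aS : (a.+1 %% L.+1 = a.+1)%N by rewrite modn_small //; lia.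
  rewrite /is_diagonal -!val_eqE /= aS.
  have [bL|bL] := eqVneq (b : nat) L.
    by rewrite bL modnn; apply/and3P; split; try lia; apply/eqP => a0; apply: nab.
  by rewrite modn_small; try lia.
- by rewrite j0 /=; lia.
- rewrite card_boundary_arc boundary_distE ltnW //; lia.
rewrite card_boundary_arc boundary_distE leqNgt ab /= mulnBr.
by have := leq_mul2l m j n; rewrite (ltnW jn) orbT; lia.
Qed.

Lemma vertexA_ex D : vertexA D -> exists x,
  [/\ D = chord x, admissible m x & ~ (x.1 = 0%N :> nat /\ x.2 = L :> nat)].
Proof.
move=> [a [b [j [-> /and3P[ab _ _] /andP[j0 jn]]]]].
rewrite !card_boundary_arc !boundary_distE => e1 e2.
have bN := ltn_ord b; have aN := ltn_ord a.
have jn' : (j <= n)%N by lia.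
have mjn : (m * (n - j) + m * j = m * n)%N by rewrite -mulnDr subnK.
have mj : (m <= m * j)%N by rewrite leq_pmulr.
have mj' : (m <= m * (n - j))%N by rewrite leq_pmulr // subn_gt0; lia.
have [ltab|ltba] := ltnP a b.
  exists (a, b); rewrite /chord /admissible /=; rewrite (ltnW ltab) /= in e1; split=> //.
    have e : (b - a - 1 = m * j)%N by lia.
    by rewrite e dvdn_mulr // andbT; lia.
  by move=> [a0 bL]; lia.
have {}ltba : (b < a)%N by rewrite ltn_neqAle eq_sym val_eqE ab.
exists (b, a); rewrite /chord /admissible /=; rewrite (ltnW ltba) /= in e2; split=> //.
- by rewrite finset.setUC.
- have e : (a - b - 1 = m * (n - j))%N by lia.
  by rewrite e dvdn_mulr // andbT; lia.
by move=> [b0 aL]; lia.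
Qed.

Lemma cross_chord x y : (x.1 < x.2)%N -> (y.1 < y.2)%N ->
  cross P (chord x) (chord y) <-> [\/ crossing x y, crossing y x | x = y].
Proof.
case: x y => [a b] [c d] /= ab cd; rewrite /chord /crossing /= crossP //; split=> -[].
- by move=> [-> -> ->]; constructor 1.
- by move=> [-> -> ->]; constructor 2.
- by move=> [-> ->]; constructor 3.
- by move=> /and3P[? ? ?]; constructor 1.
- by move=> /and3P[? ? ?]; constructor 2.
by move=> [-> ->]; constructor 3.
Qed.

(** Taking [k = m], which is positive, excludes [[0, L]]: it is a side of the polygon, not a
    diagonal. *)
Lemma faces_DeltaA : faces (DeltaA P) =
  (fun D : {set I * I} => (chord @: D)%SET) @`
    [set D : {set I * I} | dissection m 0 L m D].
Proof.
rewrite eqEsubset; split=> F.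
  move=> [Fv Fc]; pose D := [set x : I * I | (x.1 < x.2)%N && (chord x \in F)]%SET.
  exists D.
    have DE x : x \in D -> [/\ admissible m x & ~ (x.1 = 0%N :> nat /\ x.2 = L :> nat)].
      rewrite inE => /andP[x12 xF]; have [y [xy ya yN]] := vertexA_ex (Fv _ xF).
      have y12 : (y.1 < y.2)%N by case/andP: ya; lia.
      by have -> : x = y by apply: chord_inj => //; rewrite inE.
    split=> [x xD|x y xD yD|_ x xD]; last by case: (DE x xD).
      have [xa xN] := DE x xD; split=> //; by rewrite -ltnS ltn_ord.
    apply/negP => xy; move: xD yD; rewrite !inE => /andP[x12 xF] /andP[y12 yF].
    apply: (Fc _ _ xF yF); last by apply/cross_chord => //; constructor 1.
    apply: contraTneq xy => /chord_inj -> //; rewrite ?inE //.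
    by rewrite /crossing ltnn.
  apply/setP => v; apply/imsetP/idP => [[x + ->]|vF]; first by rewrite inE => /andP[].
  have [x [vx xa xN]] := vertexA_ex (Fv _ vF); exists x => //.
  by rewrite inE -vx vF andbT; case/andP: xa; lia.
move=> [D [Dv Dnc DN] <-]; split=> [v /imsetP[x xD ->]|v w].
  by apply: vertexA_chord; [case: (Dv x xD)|exact: DN].
move=> /imsetP[x xD ->] /imsetP[y yD ->] xy; rewrite cross_chord.
- move=> [h|h|h]; [by have := Dnc x y xD yD; rewrite h|by have := Dnc y x yD xD; rewrite h|].
  by rewrite h eqxx in xy.
- by have [/andP[+ _] _ _] := Dv x xD; lia.
by have [/andP[+ _] _ _] := Dv y yD; lia.
Qed.

Lemma crit_matched_DeltaA : crit_matched n.-1 (faces (DeltaA P)) (raney m n 1).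
Proof.
rewrite faces_DeltaA; apply: (@crit_matched_image _ _ [set x : I * I | (x.1 < x.2)%N]%SET).
- exact: chord_inj.
- by move=> D dD; apply/fintype.subsetP => x xD; rewrite inE (dissection_lt m_gt0 dD xD).
rewrite -(prednK n_gt0) raney1 prednK //.
have -> : L = (0 + m * n.-1 + m + 1)%N by rewrite add0n -mulnSr prednK // addn1.
apply: crit_matched_dissection => //; lia.
Qed.

End TypeA.

Lemma DeltaA_wedge (R : realType) (m n : nat) (P : 'I_(m * n).+2 -> 'rV[R]_2) :
  (0 < m)%N -> (0 < n)%N -> convex_polygon P ->
  exists k : nat, k%:R = narayanaA m n n.-1 /\
    homotopic_to_wedge_of_spheres R (realization R (DeltaA P)) k n.-1.
Proof.
move=> m0; case: n P => // n P _ convexP; exists (raney m n.+1 1).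
have := raney_tree n m0 => e; split.
  have n0 : n.+1%:R != 0 :> rat by rewrite pnatr_eq0.
  by rewrite /narayanaA /= binn mulr1 -e natrM mulrC mulfK.
apply: crit_matched_wedge; first exact: crit_matched_DeltaA.
  have : (0 < raney m n.+1 1 * n.+1)%N by rewrite e bin_gt0; nia.
  by rewrite muln_gt0 => /andP[].
by move=> n0; rewrite raney1 (n0 : n = 0%N).
Qed.

(** * Type B *)

Section TypeB.
Context (R : realType) (m n : nat) (P : 'I_(2 * m * n).+2 -> 'rV[R]_2).
Hypothesis (m_gt0 : (0 < m)%N) (n_gt0 : (0 < n)%N) (convexP : convex_polygon P).
Local Notation N := (2 * m * n).+2.
Local Notation L := (m * n + 1)%N.
Local Notation I := 'I_N.
Local Notation J := ('I_L.+1 * 'I_L.+1)%type.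
Local Notation pt := (@residue (2 * m * n).+1).
Implicit Types (x y : J) (D : {set J}) (F : {set {set {set I}}}).

Let N_eq : N = (L + L)%N. Proof. by rewrite -mulnA; lia. Qed.

(** Adding [L] is the antipodal map, as [N = L + L]. For [l = L] the two diagonals coincide in a
    diameter and the set is a singleton. *)
Definition arcB (k l : nat) : {set {set I}} :=
  [set [set pt k; pt (k + l)]; [set pt (k + L); pt (k + l + L)]]%SET.

(** The polygon is opened along the diameter at [a]: [[0, L]] runs along one half, and the antipodal
    map supplies the other. *)
Definition emb (a : nat) x := arcB (a + x.1) (x.2 - x.1).

Lemma bar_residue k : bar (pt k) = pt (k + L).
Proof. by rewrite /bar iter_ordS_residue addn1. Qed.

Lemma residue_2L k : pt (k + L + L) = pt k.
Proof. by rewrite -addnA -N_eq residue_period. Qed.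

Lemma arcB_period k l : arcB (k + L) l = arcB k l.
Proof.
by rewrite /arcB residue_2L (addnAC k L l) residue_2L finset.setUC.
Qed.

(** Gives the second chord increasing offsets below [N], as [cross_residue] requires: for [v = L]
    its end [v + L] wraps around to [0]. *)
Lemma arcB_chords a u v : (u < v <= L)%N -> exists s t,
  arcB (a + u) (v - u) = [set [set pt (a + u); pt (a + v)]; [set pt (a + s); pt (a + t)]]%SET /\
  ((v < L)%N /\ s = (u + L)%N /\ t = (v + L)%N \/ v = L /\ s = 0%N /\ t = (u + L)%N).
Proof.
move=> /andP[uv vL]; have e : (a + u + (v - u) = a + v)%N by lia.
rewrite /arcB e; have [ltvL|geLv] := ltnP v L.
  by exists (u + L)%N, (v + L)%N; rewrite !addnA; split=> //; left.
have -> : v = L by lia.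
exists 0%N, (u + L)%N; rewrite residue_2L addn0 !addnA; split; last by right.
by rewrite [X in [set _; X]%SET]finset.setUC.
Qed.

Lemma Bcross_arc a u v u' v' : (u < v <= L)%N -> (u' < v' <= L)%N ->
  Bcross P (arcB (a + u) (v - u)) (arcB (a + u') (v' - u')) <->
  [\/ (u < u')%N /\ (u' < v < v')%N, (u' < u)%N /\ (u < v' < v)%N | u = u' /\ v = v'].
Proof.
move=> uv uv'; have [s [t [e st]]] := arcB_chords a uv.
have [s' [t' [e' st']]] := arcB_chords a uv'.
have H1 : (u < v < N)%N by rewrite N_eq; lia.
have H1' : (u' < v' < N)%N by rewrite N_eq; lia.
have H2 : (s < t < N)%N by rewrite N_eq; lia.
have H2' : (s' < t' < N)%N by rewrite N_eq; lia.
rewrite e e'; split=> [[d [d' [+ + c]]]|c]; last first.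
  exists [set pt (a + u); pt (a + v)]%SET, [set pt (a + u'); pt (a + v')]%SET.
  by rewrite !inE !eqxx; split=> //; apply/(cross_residue convexP).
have goalP : (u < u')%N /\ (u' < v < v')%N \/ (u' < u)%N /\ (u < v' < v)%N \/ u = u' /\ v = v' ->
    [\/ (u < u')%N /\ (u' < v < v')%N, (u' < u)%N /\ (u < v' < v)%N | u = u' /\ v = v'].
  by move=> [h|[h|h]]; [constructor 1|constructor 2|constructor 3].
rewrite !inE => /orP[] /eqP ed /orP[] /eqP ed'; move: c; rewrite ed ed' cross_residue // => c;
  apply: goalP; clear -c uv uv' st st'; case: c; lia.
Qed.

(** An arc lying in the half opened at [a + t] does not pass over the ends of that half, so seen
    from [a] it does not pass over [t]. *)
Lemma arcB_eq a u v t u' v' : (u < v <= L)%N -> (u' < v' <= L)%N -> (t < L)%N ->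
  arcB (a + u) (v - u) = arcB (a + t + u') (v' - u') ->
  ~ (u < t < v)%N /\ (t = 0%N -> u = u' /\ v = v').
Proof.
move=> uv uv' tL; have [s [w [-> _]]] := arcB_chords a uv.
have [s' [w' [-> sw']]] := arcB_chords (a + t) uv'.
pose red k := if (k < N)%N then k else (k - N)%N.
have redE k : (k < 2 * N)%N -> pt (a + k) = pt (a + red k).
  move=> kN; rewrite /red; have [//|Nk] := ltnP k N.
  by rewrite -{1}(subnK Nk) addnA residue_period.
have redN k : (k < 2 * N)%N -> (red k < N)%N.
  by move=> kN; rewrite /red; have [//|Nk] := ltnP k N; lia.
have uN : (u < N)%N by rewrite N_eq; lia.
have vN : (v < N)%N by rewrite N_eq; lia.
have pair i j : (i < 2 * N)%N -> (j < 2 * N)%N ->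
    [set pt (a + u); pt (a + v)]%SET = [set pt (a + i); pt (a + j)]%SET ->
    u = red i /\ v = red j \/ u = red j /\ v = red i.
  move=> iN jN; rewrite (redE i) // (redE j) // => /set2_eq.
  have [ri rj] := (redN i iN, redN j jN).
  by move=> [[/(residue_inj uN ri) -> /(residue_inj vN rj) ->]|[/(residue_inj uN rj) -> /(residue_inj vN ri) ->]];
    [left|right].
move=> e; have : [set pt (a + u); pt (a + v)]%SET \in
    [set [set pt (a + t + u'); pt (a + t + v')];
         [set pt (a + t + s'); pt (a + t + w')]]%SET.
  by rewrite -e !inE eqxx.
have b1 : (t + u' < 2 * N)%N by rewrite N_eq; lia.
have b2 : (t + v' < 2 * N)%N by rewrite N_eq; lia.
have b3 : (t + s' < 2 * N)%N by rewrite N_eq; lia.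
have b4 : (t + w' < 2 * N)%N by rewrite N_eq; lia.
rewrite !inE -!addnA => /orP[] /eqP ep.
  have := pair _ _ b1 b2 ep; rewrite /red N_eq; clear -uv uv' tL.
  by case: ifP => ?; case: ifP => ?; lia.
have := pair _ _ b3 b4 ep; rewrite /red N_eq; clear -uv uv' tL sw'.
by case: ifP => ?; case: ifP => ?; lia.
Qed.

(** The two complementary paths cover all vertices, so the size of their intersection follows from
    those of the paths. *)
Lemma card_arcB_center k l : (0 < l <= L)%N ->
  (#|boundary_arc (pt (k + l)) (pt k) :&:
     boundary_arc (pt (k + l + L)) (pt (k + L))|%SET = (L - l).+1 * 2)%N.
Proof.
move=> lL; have dist q c d : boundary_dist (pt q) c = d -> pt (q + d) = c.
  have vq : (pt q : nat) = (q %% N)%N by rewrite /residue inordK ?ltn_pmod.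
  move=> <-; rewrite -[RHS](residue_boundary_dist (pt q)) vq.
  by rewrite /residue modnDml.
have lN : (l <= N)%N by rewrite N_eq; lia.
have lN' : (N - l < N)%N by rewrite N_eq; lia.
have d1 : boundary_dist (pt (k + l)) (pt k) = (N - l)%N.
  have e : (k + N = k + l + (N - l))%N by rewrite -(addnA k) subnKC.
  by rewrite -[pt k]residue_period e boundary_dist_residue.
have d2 : boundary_dist (pt (k + l + L)) (pt (k + L)) = (N - l)%N.
  have e : (k + L + N = k + l + L + (N - l))%N by rewrite (addnAC k l L) -(addnA (k + L)) subnKC.
  by rewrite -[pt (k + L)]residue_period e boundary_dist_residue.
have := cardsUI (boundary_arc (pt (k + l)) (pt k)) (boundary_arc (pt (k + l + L)) (pt (k + L))).
rewrite !card_boundary_arc d1 d2 (_ : _ :|: _ = [set: I])%SET; last first.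
  apply/setP => c; rewrite !inE d1 d2; pose t := boundary_dist (pt (k + l)) c.
  have tN : (t < N)%N := boundary_dist_lt _ _.
  have := dist _ _ _ (erefl t); rewrite -/t => ec.
  have [//|lt_t] := leqP t (N - l); rewrite /= -ec.
  have -> : pt (k + l + t) = pt (k + l + L + (t - L)).
    by congr pt; move: lt_t; rewrite N_eq; lia.
  by rewrite boundary_dist_residue; move: tN lt_t; rewrite N_eq; lia.
by rewrite cardsT card_ord; set c := #|_|; clearbody c; rewrite N_eq; lia.
Qed.

Lemma vertexB_arc k j : (0 < j <= n)%N -> vertexB P (arcB k (m * j + 1)).
Proof.
move=> /andP[j0 jn]; set l := (m * j + 1)%N.
have lL : (l <= L)%N by rewrite /l leq_add2r leq_mul2l jn orbT.
have l1 : (1 < l)%N by rewrite /l; nia.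
have d1 q : boundary_dist (pt q) (pt (q + l)) = l by rewrite boundary_dist_residue // N_eq; lia.
split; last first.
  exists (pt k), (pt (k + l)), j; rewrite !bar_residue; split=> //.
  - by rewrite j0.
  - by rewrite card_boundary_arc d1 /l; lia.
  - by rewrite card_boundary_arc addnAC d1 /l; lia.
  by rewrite card_arcB_center ?(ltnW l1) // /l -mulnA mulnBr; have := leq_mul2l m j n; lia.
have [lL'|lL'] := eqVneq l L.
  left; exists (pt k); rewrite /arcB bar_residue lL' residue_2L.
  by rewrite [X in [set _; X]%SET]finset.setUC finset.setUid.
right; exists (pt k), (pt (k + l)); rewrite !bar_residue; split=> //.
  have ne u v : (u < N)%N -> (v < N)%N -> u != v -> pt (k + u) != pt (k + v).
    by move=> uN vN; apply: contra_neq; exact: residue_inj.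
  rewrite /is_diagonal !ordS_residue -addnS -[k in pt k]addn0 -[k.+1]addn1.
  by rewrite !ne //; move: l1 lL; rewrite ?N_eq; lia.
rewrite -{1}[k]addn0 -!addnA cross_residue //; try by rewrite N_eq; lia.
by case; lia.
Qed.

Lemma vertexB_ex v : vertexB P v ->
  exists k j, [/\ (k < N)%N, (0 < j <= n)%N & v = arcB k (m * j + 1)].
Proof.
move=> [_ [a [b [j [-> jn + _ _]]]]]; rewrite card_boundary_arc => e.
exists a, j; split=> //; have d : boundary_dist a b = (m * j + 1)%N by lia.
by rewrite /arcB -d -!bar_residue residue_boundary_dist residue_val.
Qed.

Lemma admissible_range x : admissible m x ->
  exists2 j, (0 < j <= n)%N & (x.2 - x.1 = m * j + 1)%N.
Proof.
move=> /(admissibleP m_gt0)[j j0 xj]; exists j; last by lia.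
by have := ltn_ord x.2; rewrite xj ltnS j0 /=; nia.
Qed.

Lemma admissible_le x : admissible m x -> (x.1 < x.2 <= L)%N.
Proof. by move=> /andP[+ _]; have := ltn_ord x.2; lia. Qed.

Lemma emb_inj a x y : admissible m x -> admissible m y -> emb a x = emb a y -> x = y.
Proof.
move=> /admissible_le xL /admissible_le yL; rewrite /emb -[in RHS](addn0 a).
have L0 : (0 < L)%N by rewrite addn1.
move=> /(arcB_eq xL yL L0)[_ /(_ erefl)]; case: x y {xL yL} => [x1 x2] [y1 y2] /=.
by move=> [/ord_inj -> /ord_inj ->].
Qed.

Lemma Bcross_emb a x y : admissible m x -> admissible m y ->
  Bcross P (emb a x) (emb a y) <-> [\/ crossing x y, crossing y x | x = y].
Proof.
move=> /admissible_le xL /admissible_le yL; rewrite /emb Bcross_arc //.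
rewrite /crossing; split=> -[].
- by move=> [? ?]; constructor 1; lia.
- by move=> [? ?]; constructor 2; lia.
- case: x y {xL yL} => [x1 x2] [y1 y2] /= [/ord_inj -> /ord_inj ->]; by constructor 3.
- by move=> ?; constructor 1; lia.
- by move=> ?; constructor 2; lia.
by move=> ->; constructor 3.
Qed.

(* The faces that stay faces when the diameter at [a] is added. *)
Definition compatible a F := exists2 D, dissection m 0 L 0 D & F = (emb a @: D)%SET.

Lemma compatible_face a F : compatible a F -> faces (DeltaB P) F.
Proof.
move=> [D [Dv Dnc _] ->]; split=> [v /imsetP[x xD ->]|v w].
  have [xa _ _] := Dv x xD; have [j jn xj] := admissible_range xa.
  by rewrite /emb xj; exact: vertexB_arc.
move=> /imsetP[x xD ->] /imsetP[y yD ->] xy.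
have [xa _ _] := Dv x xD; have [ya _ _] := Dv y yD.
rewrite Bcross_emb // => -[h|h|h].
- by have := Dnc x y xD yD; rewrite h.
- by have := Dnc y x yD xD; rewrite h.
by rewrite h eqxx in xy.
Qed.

Lemma face_compatible a F : faces (DeltaB P) F ->
  (forall v, v \in F -> exists2 x, admissible m x & v = emb a x) -> compatible a F.
Proof.
move=> [Fv Fc] Fa; exists [set x | admissible m x && (emb a x \in F)]%SET.
  split=> // [x|x y]; first by rewrite inE => /andP[xa _]; split=> //; rewrite -ltnS ltn_ord.
  rewrite !inE => /andP[xa xF] /andP[ya yF]; apply/negP => xy.
  apply: (Fc _ _ xF yF); last by apply/Bcross_emb => //; constructor 1.
  by apply: contraTneq xy => /(emb_inj xa ya) ->; rewrite /crossing ltnn.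
apply/setP => v; apply/idP/imsetP => [vF|[x + ->]]; last by rewrite inE => /andP[].
by have [x xa vx] := Fa v vF; exists x => //; rewrite inE xa -vx.
Qed.

Lemma compatible_sub a F F' : F \subset F' -> compatible a F' -> compatible a F.
Proof.
move=> FF' [D [Dv Dnc _] F'D]; exists [set x in D | emb a x \in F]%SET.
  split=> // [x|x y]; first by rewrite inE => /andP[/Dv].
  by rewrite !inE => /andP[xD _] /andP[yD _]; exact: Dnc.
apply/setP => v; apply/idP/imsetP => [vF|[x + ->]]; last by rewrite inE => /andP[].
have := fintype.subsetP FF' v vF; rewrite F'D => /imsetP[x xD vx].
by exists x => //; rewrite inE xD -vx.
Qed.

Lemma emb_ival a u l : (u + l <= L)%N -> emb a (ival L u (u + l)) = arcB (a + u) l.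
Proof.
move=> uL; have uL' : (u <= L)%N by lia.
by rewrite /emb (ivalE uL' uL).1 (ivalE uL' uL).2 addKn.
Qed.

(* The starting point of a longest arc lies under no other arc. *)
Lemma compatible_ex F : faces (DeltaB P) F -> exists2 a, (a < L)%N & compatible a F.
Proof.
move=> fF; have [Fv Fc] := fF.
have [F0|[v0 v0F]] := set_0Vmem F.
  exists 0%N; first by rewrite addn1.
  by apply: face_compatible => // v; rewrite F0 finset.in_set0.
pose A j := `[< exists2 k, (k < N)%N & (0 < j <= n)%N /\ arcB k (m * j + 1) \in F >].
have exA : exists j, A j.
  have [k [j [kN jn vE]]] := vertexB_ex (Fv _ v0F).
  by exists j; apply/asboolP; exists k => //; rewrite -vE.
have An j : A j -> (j <= n)%N by move=> /asboolP[k _ [/andP[]]].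
case: (ex_maxnP exA An) => j0 /asboolP[k0 k0N [j0n k0F]] j0max.
set l0 := (m * j0 + 1)%N in k0F.
have mod_L k : (k < N)%N -> exists2 a, (a < L)%N & (k = a \/ k = a + L)%N.
  move=> kN; have [kL|kL] := ltnP k L; first by exists k => //; left.
  by exists (k - L)%N; [move: kN; rewrite N_eq; lia|right; lia].
have [a aL k0a] := mod_L k0 k0N.
have v0E : arcB a l0 \in F by case: k0a k0F => ->; rewrite ?arcB_period.
exists a => //; apply: face_compatible => // v vF.
have [k [j [kN jn vE]]] := vertexB_ex (Fv _ vF).
have l_le : (m * j + 1 <= l0)%N.
  rewrite leq_add2r leq_mul2l j0max ?orbT //; apply/asboolP.
  by exists k => //; rewrite -vE.
have [b bL kb] := mod_L k kN.
have {}vE : v = arcB b (m * j + 1) by rewrite vE; case: kb => ->; rewrite ?arcB_period.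
have [u uL bu] : exists2 u, (u < L)%N & arcB b (m * j + 1) = arcB (a + u) (m * j + 1).
  have [ab|ba] := leqP a b; first by exists (b - a)%N; [lia|rewrite subnKC].
  exists (b + L - a)%N; first lia.
  by rewrite subnKC ?arcB_period //; lia.
rewrite {}bu in vE; have /andP[j_gt0 jn'] := jn; have /andP[_ j0n'] := j0n.
have [uj|ltLu] := leqP (u + (m * j + 1)) L.
  exists (ival L u (u + (m * j + 1))); last by rewrite emb_ival.
  by move: uj; rewrite addnA; exact: admissible_ival.
have l0L : (0 < l0 <= L)%N by rewrite /l0 addn1 /= addn1 ltnS leq_mul2l j0n' orbT.
have u0 : (0 < u)%N by lia.
have [s [t [e0 st]]] := arcB_chords a l0L.
have {}e0 : arcB a l0 = [set [set pt (a + 0); pt (a + l0)]; [set pt (a + s); pt (a + t)]]%SET.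
  by rewrite -e0 addn0 subn0.
set w := (u + (m * j + 1))%N in ltLu.
have eW : (a + u + (m * j + 1) = a + w)%N by rewrite -addnA.
have dv : [set pt (a + u); pt (a + w)]%SET \in v by rewrite vE !inE eW eqxx.
have wN : (w < N)%N by rewrite /w N_eq; lia.
have sN : (s < N)%N by rewrite N_eq; lia.
have tN : (t < N)%N by rewrite N_eq; lia.
have uN : (u < N)%N by rewrite N_eq; lia.
have l0N : (l0 < N)%N by rewrite N_eq; lia.
(* The arc of [v] passes over [a + L]. Being no longer than [l0], it ends before [a + L + l0], so it
   crosses the antipodal copy of the longest arc, or the diameter at [a] if [l0 = L]. *)
case: (Fc v (arcB a l0) vF v0E).
  have pI i j : (i < N)%N -> (j < N)%N -> pt (a + i) = pt (a + j) -> i = j := @residue_inj _ a i j.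
  have oN : (0 < N)%N by [].
  apply/eqP => v_v0; move: dv; rewrite v_v0 e0 !inE => /orP[] /eqP /set2_eq.
    by move=> [[/(pI _ _ uN oN) ? _]|[_ /(pI _ _ wN oN) ?]]; lia.
  move=> [[/(pI _ _ uN sN) us /(pI _ _ wN tN) wt]|[/(pI _ _ uN tN) ut _]].
    by rewrite /w in wt ltLu; clear -us wt st u0 uL l_le ltLu l0L; lia.
  by clear -ut st u0 uL l0L; lia.
exists [set pt (a + u); pt (a + w)]%SET, [set pt (a + s); pt (a + t)]%SET.
rewrite dv e0 !inE eqxx orbT; split=> //; rewrite cross_residue //; try by lia.
case: st => [[? [-> ->]]|[? [-> ->]]]; [constructor 1|constructor 2]; rewrite /w; lia.
Qed.

(** Intervals after [t] are shifted back by [t]; those before it reappear at the far end as their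
    antipodal copies, shifted by [L - t]. Only an interval over [t] has no place in the new half. *)
Lemma compatible_rotate D a t : dissection m 0 L 0 D -> (0 < t)%N -> (a + t < L)%N ->
  compatible (a + t) (emb a @: D)%SET <-> ~ exists2 x, x \in D & (x.1 < t < x.2)%N.
Proof.
move=> dD t0 atL; have [Dv _ _] := dD; have tL : (t < L)%N by lia.
split=> [[D' [D'v _ _] e] [x xD xt]|noD].
  have : emb a x \in (emb a @: D)%SET by exact: imset_f.
  rewrite e => /imsetP[y yD' xy].
  have [xa _ _] := Dv x xD; have [ya _ _] := D'v y yD'.
  by have [] := arcB_eq (admissible_le xa) (admissible_le ya) tL xy.
apply: face_compatible; first by apply: compatible_face; exists D.
have emb_ival' u j : (u + m * j + 1 <= L)%N ->
    emb (a + t) (ival L u (u + m * j + 1)) = arcB (a + t + u) (m * j + 1).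
  by rewrite -(addnA u) => uL; rewrite emb_ival.
suff key x : x \in D -> exists2 y, admissible m y & emb a x = emb (a + t) y.
  by move=> _ /imsetP[x xD ->]; exact: key.
move=> xD; have [xa _ _] := Dv x xD.
have /andP[x12 x2L] := admissible_le xa.
have [j j0 xj] := admissibleP m_gt0 xa.
have -> : emb a x = arcB (a + x.1) (m * j + 1) by rewrite /emb xj -addnA addKn.
have [ltx|lex] := ltnP x.1 t.
  have xt : (x.2 <= t)%N by rewrite leqNgt; apply/negP => ?; apply: noD; exists x; rewrite ?ltx.
  have uL : (x.1 + L - t + m * j + 1 <= L)%N by move: xt; rewrite xj => xt'; clear - xt' tL; lia.
  exists (ival L (x.1 + L - t) (x.1 + L - t + m * j + 1)).
    exact: admissible_ival.
  rewrite emb_ival' // -arcB_period; congr arcB; clear -tL; lia.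
have uL : (x.1 - t + m * j + 1 <= L)%N by move: x2L; rewrite xj => x2L'; clear - x2L'; lia.
exists (ival L (x.1 - t) (x.1 - t + m * j + 1)).
  exact: admissible_ival.
by rewrite emb_ival' //; congr arcB; clear -lex; lia.
Qed.

(** * Faces sorted by their last compatible diameter *)

Definition last_compatible a : set {set {set {set I}}} := [set F | compatible a F /\
  forall a', (a < a' < L)%N -> ~ compatible a' F].

(** If [r] is in [D], the diameter at [a] is in the face and crosses all other diameters. If not,
    each later diameter has to be crossed by an interval of [D]. *)
Lemma last_compatible_rooted a :
  last_compatible a = (fun D => (emb a @: D)%SET) @` @rooted m L n a.
Proof.
rewrite eqEsubset; split=> F.
  move=> [[D dD ->] Da]; exists D => //; split=> //; right=> t t0 atL.
  apply: contrapT => noD; apply: (Da (a + t)%N); first by lia.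
  exact/compatible_rotate.
move=> [D [dD rD] <-]; split; first by exists D.
move=> a' /andP[aa' a'L]; rewrite -(subnKC (ltnW aa')) => /compatible_rotate.
have t0 : (0 < a' - a)%N by lia.
have atL : (a + (a' - a) < L)%N by lia.
move=> /(_ dD t0 atL); apply; case: rD => [rD|]; last exact.
exists (ival L 0 L) => //.
by rewrite (ivalE (leq0n L) (leqnn L)).1 (ivalE (leq0n L) (leqnn L)).2 t0; lia.
Qed.

Lemma crit_matched_last_compatible a : crit_matched n (last_compatible a)
  (\sum_(i < n) (a < m * (n - i)) * (raney m i 1 * raney m (n.-1 - i) m.-1)).
Proof.
rewrite last_compatible_rooted.
apply: (@crit_matched_image _ _ [set x : J | admissible m x]%SET); last exact: crit_matched_rooted.
  by move=> x y; rewrite !inE; exact: emb_inj.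
by move=> D [[Dv _ _] _]; apply/fintype.subsetP => x xD; rewrite inE; case: (Dv x xD).
Qed.

Lemma sum_lt k c : (\sum_(i < k) (i < c) = minn k c)%N.
Proof.
elim: k => [|k IH]; first by rewrite big_ord0 min0n.
by rewrite big_ord_recr /= IH; case: ltnP; lia.
Qed.

(** A larger face has fewer compatible diameters, so its last one can only come earlier; reversing
    the index gives increasing layers. Summing the condition [a < m * (n - j)] over [a] yields the
    factor [m * (n - j)] of [raney_cyclic]. *)
Lemma crit_matched_DeltaB : crit_matched n (faces (DeltaB P)) 'C(m * n, n).
Proof.
pose Q i : set {set {set {set I}}} := [set F | (i < L)%N /\ last_compatible (L.-1 - i) F].
have -> : faces (DeltaB P) = [set F | exists2 i, (i < L)%N & Q i F].
  rewrite eqEsubset; split=> F; last by move=> [i _ [_ [/compatible_face]]].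
  move=> fF; pose A a := (a < L)%N && `[< compatible a F >].
  have exA : exists a, A a.
    by have [a aL aF] := compatible_ex fF; exists a; rewrite /A aL; apply/asboolP.
  have AL a : A a -> (a <= L)%N by move=> /andP[/ltnW].
  case: (ex_maxnP exA AL) => a /andP[aL /asboolP aF] amax.
  have e : (L.-1 - (L.-1 - a) = a)%N by lia.
  exists (L.-1 - a)%N; first lia.
  split; first lia.
  rewrite e; split=> // a' /andP[aa' a'L] a'F.
  have : (a' <= a)%N by apply: amax; rewrite /A a'L; apply/asboolP.
  by rewrite leqNgt aa'.
have -> : 'C(m * n, n) = (\sum_(i < L) \sum_(j < n)
    (L.-1 - i < m * (n - j)) * (raney m j 1 * raney m (n.-1 - j) m.-1))%N.
  rewrite -raney_cyclic // exchange_big /=; apply: eq_bigr => j _.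
  rewrite -big_distrl /=; congr (_ * _)%N.
  rewrite (reindex_inj rev_ord_inj) /=.
  rewrite (eq_bigr (fun i : 'I_L => (i < m * (n - j)) : nat)) => [|i _]; last first.
    by congr nat_of_bool; congr (_ < _)%N; have := ltn_ord i; lia.
  rewrite sum_lt; apply/esym/minn_idPr.
  by rewrite mulnBr; lia.
apply: (@crit_matched_bigcup _ Q _ (fun i => \sum_(j < n) (L.-1 - i < m * (n - j)) *
  (raney m j 1 * raney m (n.-1 - j) m.-1))%N) => [i iL|i i' F F'].
  have -> : Q i = last_compatible (L.-1 - i).
    by rewrite eqEsubset; split=> F; [case|].
  exact: crit_matched_last_compatible.
move=> [iL [_ Fmax]] [i'L [F'c _]] FF'; rewrite leqNgt; apply/negP => i'i.
by apply: (Fmax (L.-1 - i')%N); [lia|exact: compatible_sub F'c].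
Qed.

End TypeB.

Lemma DeltaB_wedge (R : realType) (m n : nat) (P : 'I_(2 * m * n).+2 -> 'rV[R]_2) :
  (0 < m)%N -> (0 < n)%N -> convex_polygon P ->
  exists k : nat, k%:R = narayanaB m n n /\
    homotopic_to_wedge_of_spheres R (realization R (DeltaB P)) k n.
Proof.
move=> m0 n0 convexP; exists 'C(m * n, n); split.
  by rewrite /narayanaB binn mul1r.
apply: crit_matched_wedge; first exact: crit_matched_DeltaB.
  by rewrite bin_gt0 leq_pmull.
by move=> nz; rewrite nz in n0.
Qed.

Theorem corollary1p5 (R : realType) (m n : nat)
  (m_ge1 : (1 <= m)%N) (n_ge1 : (1 <= n)%N) :
  (forall P : 'I_(m * n).+2 -> 'rV[R]_2,
     convex_polygon P ->
     exists k : nat, k%:R = narayanaA m n n.-1 /\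
       homotopic_to_wedge_of_spheres R (realization R (DeltaA P)) k n.-1) /\
  (forall P : 'I_(2 * m * n).+2 -> 'rV[R]_2,
     convex_polygon P -> centrally_symmetric P ->
     exists k : nat, k%:R = narayanaB m n n /\
       homotopic_to_wedge_of_spheres R (realization R (DeltaB P)) k n).
Proof.
split=> [P convexP|P convexP _]; first exact: DeltaA_wedge.
exact: DeltaB_wedge.
Qed.
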